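(* Let $\alpha\in\mathfrak g$ and let $u:\mathbb R\times S^1\to M$ be a smooth twisted harmonic map with respect to the flat connection $A=\alpha\,d\theta$, i.e. $D_A^*D_Au=0$. There is $\varepsilon'_\alpha>0$ depending only on $\alpha$ (and $M$) such that if $$\sup_{t\in\mathbb R}\|D_Au\|_{L^2([t-1,t+1]\times S^1)}\le\varepsilon'_\alpha,$$ then $\partial_{\theta,\alpha}u\equiv0$, i.e. $u$ is a twisted geodesic: for every $\theta$ the curve $t\mapsto u(t,\theta)$ is a geodesic of $M$ and $u$ takes values in the fixed point set $M^\alpha$ of $\exp(2\pi\alpha)$. In particular, if $\alpha$ is non-critical, then $u$ takes values in $M_0$ and each $t\mapsto u(t,\theta)$ is a geodesic in $M_0$.
   Context: $G$ is a compact connected Lie group with Lie algebra $\mathfrak g$ acting isometrically on a compact manifold $M$, $G$-equivariantly embedded in $\mathbb R^K$ with $G$ acting via an orthogonal representation; $\xi\in\mathfrak g$ is viewed as a skew-symmetric matrix acting by $y\mapsto\xi y$. For the flat connection $A=\alpha\,d\theta$ on $\mathbb R\times S^1$, $D_Au=\partial_tu\,dt+\partial_{\theta,\alpha}u\,d\theta$ with $\partial_{\theta,\alpha}u=\partial_\theta u+\alpha u$, and $D_A^*$ is the formal adjoint (flat metric $dt^2+d\theta^2$); $D_A^*D_Au=0$ is equivalent to $(\partial_t^2u+\partial_{\theta,\alpha}^2u)^\top=0$, $\top$ denoting projection onto $TM$. $M_0$ is the set of points of $M$ fixed by all of $G$; $M^\alpha$ is the fixed point set of $\exp(2\pi\alpha)$.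 $\alpha$ is called non-critical if $M^\alpha=M_0$. *)

(* Defs.v *)
From HB Require Import structures.
From mathcomp Require Import all_boot all_order all_algebra.
From mathcomp Require Import all_classical all_reals all_analysis.
Set Implicit Arguments. Unset Strict Implicit. Unset Printing Implicit Defensive.
Import Order.TTheory GRing.Theory Num.Theory.
Import numFieldNormedType.Exports.
Local Open Scope classical_set_scope.
Local Open Scope ring_scope.

Section Defs.
Variable R : realType.
Variable K : nat.
Notation V := 'cV[R]_K.
Notation Mat := 'M[R]_K.

Definition dotv (v w : V) : R := (v^T *m w) ord0 ord0.
Definition sqnorm (v : V) : R := dotv v v.

Fixpoint dirder (c : nat) (vs : seq V) (F : V -> 'cV[R]_c) : V -> 'cV[R]_c :=
  match vs with
  | [::] => F
  | v :: vs' => fun x => 'D_v (dirder vs' F) x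
  end.

Definition smooth_on (c : nat) (U : set V) (F : V -> 'cV[R]_c) : Prop :=
  forall vs : seq V,
    (forall x, U x -> forall v : V, derivable (dirder vs F) x v) /\
    (forall x, U x -> {for x, continuous (dirder vs F)}).

Definition submanifold (M : set V) : Prop :=
  forall p, M p -> exists (U : set V) (c : nat) (F : V -> 'cV[R]_c),
    [/\ open U, U p, smooth_on U F,
        (forall x, U x -> forall w : 'cV[R]_c, exists v : V, 'D_v F x = w)
      & (forall x, U x -> (M x <-> F x = 0))].

Definition tangent_vec (S : set V) (p v : V) : Prop :=
  exists gam : R -> V, [/\ (forall s, S (gam s)), gam 0 = p,
    derivable gam 0 1 & derive1 gam 0 = v].

Definition normal_to (S : set V) (p w : V) : Prop :=
  forall v, tangent_vec S p v -> dotv v w = 0.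

Definition expm (A : Mat) : Mat :=
  lim ((fun n : nat => \sum_(k < n) (k`!%:R)^-1 *: (A ^+ k)) @ \oo).

(** G is (the image of) a compact connected Lie group acting on R^K by an
    orthogonal representation and preserving M. *)
Definition orth_group_acting (G : set Mat) (M : set V) : Prop :=
  [/\ G 1%:M /\ (forall g h, G g -> G h -> G (g *m h)),
      (forall g, G g -> G g^T /\ g^T *m g = 1%:M),
      compact G, connected G
    & (forall g p, G g -> M p -> M (g *m p))].

Definition lie_alg (G : set Mat) (xi : Mat) : Prop :=
  forall t : R, G (expm (t *: xi)).

Definition fixset0 (G : set Mat) (M : set V) : set V :=
  [set p | M p /\ forall g, G g -> g *m p = p].
Definition fixset_alpha (M : set V) (alpha : Mat) : set V :=
  [set p | M p /\ expm ((2 * pi) *: alpha) *m p = p].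
Definition noncritical (G : set Mat) (M : set V) (alpha : Mat) : Prop :=
  fixset_alpha M alpha = fixset0 G M.

(** Maps u : R x S^1 -> R^K, represented as u t theta, 2pi-periodic in theta. *)
Definition dt (u : R -> R -> V) : R -> R -> V :=
  fun t th => derive1 (fun s => u s th) t.
Definition dth (u : R -> R -> V) : R -> R -> V :=
  fun t th => derive1 (u t) th.
Definition dtha (alpha : Mat) (u : R -> R -> V) : R -> R -> V :=
  fun t th => dth u t th + alpha *m u t th.

Fixpoint pder (s : seq bool) (u : R -> R -> V) : R -> R -> V :=
  match s with
  | [::] => u
  | b :: s' => if b then dt (pder s' u) else dth (pder s' u)
  end.

Definition smooth2 (u : R -> R -> V) : Prop :=
  forall s : seq bool,
    (forall t th, derivable (fun t' => pder s u t' th) t 1 /\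
                  derivable (pder s u t) th 1) /\
    continuous (fun q : R * R => pder s u q.1 q.2).

Definition on_cylinder (u : R -> R -> V) : Prop :=
  forall t th, u t (th + 2 * pi) = u t th.

Definition twisted_harmonic (M : set V) (alpha : Mat) (u : R -> R -> V) : Prop :=
  [/\ smooth2 u, on_cylinder u, (forall t th, M (u t th))
    & forall t th, normal_to M (u t th)
        (dt (dt u) t th + dtha alpha (dtha alpha u) t th)].

Definition energy_sq (alpha : Mat) (u : R -> R -> V) (t : R) : \bar R :=
  (\int[lebesgue_measure]_(s in `[(t - 1)%R, (t + 1)%R])
     \int[lebesgue_measure]_(th in `[0%R, (2 * pi)%R])
        (sqnorm (dt u s th) + sqnorm (dtha alpha u s th))%R%:E)%E.

Definition geodesic_in (S : set V) (gam : R -> V) : Prop :=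
  (forall t, S (gam t)) /\ forall t, normal_to S (gam t) (derive1 (derive1 gam) t).

End Defs.

(* Main.v *)
Require Import Defs.
From HB Require Import structures.
From mathcomp Require Import all_boot all_order all_algebra.
From mathcomp Require Import all_classical all_reals all_analysis.
From mathcomp Require Import ring lra.
Import Order.TTheory GRing.Theory Num.Theory.
Import numFieldNormedType.Exports.
Set Implicit Arguments. Unset Strict Implicit. Unset Printing Implicit Defensive.
Local Open Scope classical_set_scope.
Local Open Scope ring_scope.

(** Write [W = D u] for the twisted angular derivative, [N] for the tension
    [u_tt + D D u], which is normal to [M], [e = |u_t|^2 + |W|^2], and integrate
    over circles [{t} x S^1].  Comparing [N] with the second derivatives of the
    curves [s |-> u (s + t) th] and [s |-> exp (s alpha) u t (s + th)], which lie
    in [M], bounds [|N|] by [C e] and [|<D W, N>|] by [C^2 e |W|^2].  Let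
    [F = \int |W|^2], [B = \int |D W|^2], [a = \int e].  Integration by parts
    gives [F'' = 2 \int (|W_t|^2 + |D W|^2 - <D W, N>)], and the Hopf identity says
    that [a - 2 F] is constant in [t].  Two bounds of [sup |W|^2] are used: by
    [(1/T + l) F + B / l] for every [l > 0], and by [c B], a Poincare inequality
    which holds because the mean of the untwisted field [exp (th alpha) W] lies in
    the image of [h - 1] for the holonomy [h = exp (2 pi alpha)].  The first bound
    and Heinz's trick in the variable [t] alone turn small energy on unit cylinders
    into smallness of [a]; the second then gives [F'' >= B], so that [F], convex
    and bounded on the line, is constant, whence [B = 0] and [W = 0]. *)

(** * Matrix calculus and the matrix exponential *)

Section MatrixCalculus.
Variable R : realType.

(** A gap of this kind usually rests on a regularity estimate bounding [e] pointwise by the energy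
    of small discs. No such estimate is needed here: the only nonlinear term carries the factor
    [|W|^2], so its circle integral is at most [(C^2 + 1) a sup |W|^2], and [W] alone has to be
    bounded pointwise, along a circle, where one dimension makes this easy. What remains concerns
    functions of [t]. With [H] the Hopf constant, [a = H + 2 F], so no equation for [u_t] is
    required, and [|H| <= a] makes [H] small. Two sup bounds are used because the hypothesis makes
    [a] small only on average: the Poincare bound costs a multiple of [B a], absorbed by [2 B] only
    once [a] is pointwise small, whereas the bound with [l] of the order of [a] always lets [B] be
    absorbed and leaves [F'' >= - k m^3]. The cube is the exponent for which Heinz's trick on
    intervals of length of order [1 / m] gives an energy quantum independent of [m]. Since tangent
    vectors are velocities of curves in [M], the curvature bound requires kernel vectors of the
    Jacobian of local equations to be realised by curves; hence a Newton iteration. *)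

Lemma norm_coord_le m n (A : 'M[R]_(m, n)) i j : `|A i j| <= `|A|.
Proof.
rewrite [leRHS]/Num.Def.normr/= mx_normrE.
exact: (@le_bigmax _ _ _ _ (fun p : 'I_m * 'I_n => `|A p.1 p.2|) (i, j)).
Qed.

Lemma mx_norm_le m n (A : 'M[R]_(m, n)) e : 0 <= e ->
  (forall i j, `|A i j| <= e) -> `|A| <= e.
Proof.
move=> e0 H; rewrite /Num.Def.normr/= mx_normrE.
by apply: bigmax_le => // -[i j] _; exact: H.
Qed.

Lemma cvg_mx (T : Type) (F : set_system T) {FF : Filter F} m n
    (f : T -> 'M[R]_(m, n)) (l : 'M[R]_(m, n)) :
  (forall i j, (fun x => f x i j) @ F --> l i j) -> f @ F --> l.
Proof.
move=> H; apply/cvgrPdist_le => /= e e0.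
suff : \forall x \near F, forall p : 'I_m * 'I_n, `|l p.1 p.2 - f x p.1 p.2| <= e.
  apply: filterS => x Hx; apply: mx_norm_le (ltW e0) _ => i j.
  by rewrite !mxE; exact: (Hx (i, j)).
by apply: filter_forall => -[i j]; move/cvgrPdist_le : (H i j); apply.
Qed.

Lemma cvg_sum_fin (T : Type) (F : set_system T) {FF : Filter F}
    (W : normedModType R) n (f : 'I_n -> T -> W) (l : 'I_n -> W) :
  (forall i, f i @ F --> l i) ->
  (fun x => \sum_i f i x) @ F --> \sum_i l i.
Proof. by move=> H; apply: cvg_big => //; exact: add_continuous. Qed.

Lemma is_derive_mxP (V : normedModType R) m n (f : V -> 'M[R]_(m, n)) x v df :
  is_derive x v f df <-> forall i j, is_derive x v (fun y => f y i j) (df i j).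
Proof.
split=> [[Df <-] i j|H].
  apply: DeriveDef; first by move/derivable_mxP : Df.
  by rewrite (derive_mx Df) mxE.
have Df : derivable f x v by apply/derivable_mxP => i j; have [] := H i j.
apply: DeriveDef => //; rewrite (derive_mx Df); apply/matrixP => i j.
by rewrite mxE; have [] := H i j.
Qed.

Lemma is_derive_sum_fct (V W : normedModType R) n (h : 'I_n -> V -> W) x v
    (dh : 'I_n -> W) : (forall i, is_derive x v (h i) (dh i)) ->
  is_derive x v (fun y => \sum_(i < n) h i y) (\sum_(i < n) dh i).
Proof.
move=> H; have := is_derive_sum H; congr (is_derive _ _ _ _).
by apply/funext => y; rewrite fct_sumE.
Qed.

Lemma is_derive_mulmx (V : normedModType R) m n p (A : V -> 'M[R]_(m, n))
    (B : V -> 'M[R]_(n, p)) x v dA dB :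
  is_derive x v A dA -> is_derive x v B dB ->
  is_derive x v (fun y => A y *m B y) (dA *m B x + A x *m dB).
Proof.
move=> /is_derive_mxP HA /is_derive_mxP HB; apply/is_derive_mxP => i j.
under eq_fun do rewrite mxE.
rewrite !mxE -big_split /=; apply: is_derive_sum_fct => k.
have H : is_derive x v (fun y => A y i k * B y k j) _ := is_deriveM (HA i k) (HB k j).
by apply: (is_derive_eq H); rewrite /GRing.scale /=; ring.
Qed.

Lemma is_derive_mulmxl (V : normedModType R) m n p (A : 'M[R]_(m, n))
    (B : V -> 'M[R]_(n, p)) x v dB :
  is_derive x v B dB -> is_derive x v (fun y => A *m B y) (A *m dB).
Proof.
move=> HB; apply: is_derive_eq.
  exact: is_derive_mulmx (is_derive_cst A x v) HB.
by rewrite mul0mx add0r.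
Qed.

Lemma is_derive_dotv (V : normedModType R) n (f g : V -> 'cV[R]_n) x v df dg :
  is_derive x v f df -> is_derive x v g dg ->
  is_derive x v (fun y => dotv (f y) (g y)) (dotv df (g x) + dotv (f x) dg).
Proof.
move=> Hf Hg.
have Hft : is_derive x v (fun y => (f y)^T) df^T.
  apply/is_derive_mxP => i j; rewrite mxE; under eq_fun do rewrite mxE.
  by move/is_derive_mxP : Hf; apply.
have /is_derive_mxP := is_derive_mulmx Hft Hg.
by move=> /(_ ord0 ord0); rewrite mxE.
Qed.

Lemma is_derive_shift1 (W : normedModType R) (f : R -> W) (x a : R) df :
  is_derive (x + a) 1 f df -> is_derive x 1 (fun s => f (s + a)) df.
Proof.
have E : (fun h : R => h^-1 *: (((fun s => f (s + a)) \o shift x) (h *: 1) - f (x + a))) =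
     (fun h : R => h^-1 *: ((f \o shift (x + a)) (h *: 1) - f (x + a))).
  by apply/funext => h /=; rewrite addrA.
case=> D V0; apply: DeriveDef; first by rewrite /derivable E.
by rewrite -V0 /derive E.
Qed.

Lemma is_derive_continuous (W : normedModType R) (f : R -> W) (x : R) df :
  is_derive x 1 f df -> {for x, continuous f}.
Proof. by case=> /derivable1_diffP /differentiable_continuous. Qed.

End MatrixCalculus.

Section MatrixExponential.
Variables (R : realType) (K : nat) (A : 'M[R]_K).

Let s : R := \sum_i \sum_j `|A i j|.
(** Taylor coefficients of the entries of [A^m exp (t A)]; the shift [m] makes termwise
    differentiation a mere increment of [m]. *)
Let coef m i j k : R := (k`!%:R)^-1 * (A ^+ (k + m)) i j.

Let s_ge0 : 0 <= s. Proof. by apply: sumr_ge0 => i _; apply: sumr_ge0. Qed.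

Let pow_le k i j : `|(A ^+ k) i j| <= s ^+ k.
Proof.
elim: k i j => [|k IH] i j.
  by rewrite expr0 mxE; case: (_ == _); rewrite ?normr1 ?normr0.
rewrite !exprS mxE; apply: le_trans (ler_norm_sum _ _ _) _.
under eq_bigr do rewrite normrM.
apply: (@le_trans _ _ (\sum_l `|A i l| * s ^+ k)).
  by apply: ler_sum => l _; apply: ler_wpM2l.
rewrite -mulr_suml; apply: ler_wpM2r; first exact: exprn_ge0.
rewrite /s [leRHS](bigD1 i) //= lerDl; apply: sumr_ge0 => l _; exact: sumr_ge0.
Qed.

(** The entries of [A ^+ k] are at most [s ^+ k], so the series is dominated by [s ^+ m] times that
    of [exp (s |x|)]. *)
Let cvg_coef m i j x : cvgn (pseries (coef m i j) x).
Proof.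
apply: normed_cvg; rewrite /normed_series_of /=.
apply: (@series_le_cvg _ _ (fun k => s ^+ m * exp_coeff (s * `|x|) k)) => [k|k|k|].
- by [].
- by rewrite mulr_ge0 ?exprn_ge0 // exp_coeff_ge0 // mulr_ge0.
- rewrite /coef /exp_coeff /= !normrM normrX exprMn.
  rewrite (ger0_norm (_ : 0 <= (k`!%:R)^-1)); last by rewrite invr_ge0.
  have := pow_le (k + m) i j; rewrite (exprD s) => H.
  rewrite [leRHS](_ : _ = k`!%:R^-1 * (s ^+ k * s ^+ m) * `|x| ^+ k); last by ring.
  apply: ler_wpM2r; first exact: exprn_ge0.
  by rewrite ler_pM2l ?invr_gt0 ?ltr0n ?fact_gt0.
- exact: is_cvg_seriesZ (is_cvg_series_exp_coeff _).
Qed.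

Let diffs_coef m i j : pseries_diffs (coef m i j) = coef m.+1 i j.
Proof.
apply/funext => k; rewrite /pseries_diffs /coef factS natrM invfM mulrA.
by rewrite addnS addSn !mulrA divff ?mul1r ?pnatr_eq0.
Qed.

Let exprZ_mx (t : R) k : (t *: A) ^+ k = t ^+ k *: A ^+ k.
Proof.
elim: k => [|k IH]; first by rewrite !expr0 scale1r.
by rewrite !exprS IH -[LHS]/(_ *m _) -scalemxAl -scalemxAr scalerA.
Qed.

Lemma expm_coord t i j : expm (t *: A) i j = limn (pseries (coef 0 i j) t).
Proof.
pose L : 'M[R]_K := \matrix_(i, j) limn (pseries (coef 0 i j) t).
rewrite /expm (_ : lim _ = L) ?mxE //; apply/cvg_lim => //; apply: cvg_mx => a b.
rewrite mxE; rewrite [X in X @ _ --> _](_ : _ = pseries (coef 0 a b) t).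
  exact: cvg_coef.
apply/funext => n; rewrite /pseries /series /= summxE big_mkord.
by apply: eq_bigr => k _; rewrite mxE /coef addn0 exprZ_mx mxE; ring.
Qed.

Lemma is_derive_expm (t : R) :
  is_derive t 1 (fun s => expm (s *: A)) (A *m expm (t *: A)).
Proof.
apply/is_derive_mxP => i j; rewrite mxE.
under eq_fun do rewrite expm_coord.
under eq_bigr do rewrite expm_coord.
have -> : \sum_l A i l * limn (pseries (coef 0 l j) t) =
    limn (pseries (pseries_diffs (coef 0 i j)) t).
  rewrite diffs_coef; apply/esym/cvg_lim => //.
  have E : pseries (coef 1 i j) t =
     (fun n => \sum_l A i l * pseries (coef 0 l j) t n).
    apply/funext => n; rewrite /pseries /series /=.
    under [RHS]eq_bigr do rewrite mulr_sumr.
    rewrite exchange_big; apply: eq_bigr => k _.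
    rewrite /coef addn1 addn0 exprS mxE mulr_sumr mulr_suml.
    by apply: eq_bigr => l _; ring.
  rewrite E; apply: cvg_sum_fin => l; apply: cvgMl_tmp; exact: cvg_coef.
(* Any point of modulus larger than [|t|] will do, since the series converge everywhere. *)
apply: (@pseries_snd_diffs _ _ (`|t| + 1)); rewrite ?diffs_coef; try exact: cvg_coef.
by rewrite (@ger0_norm _ (_ + _)) ?ltrDl // addr_ge0.
Qed.

Lemma expm_comm t : A *m expm (t *: A) = expm (t *: A) *m A.
Proof.
apply/matrixP => i j; rewrite !mxE.
under eq_bigr do rewrite expm_coord.
under [RHS]eq_bigr do rewrite expm_coord.
have E : (fun n => \sum_l A i l * pseries (coef 0 l j) t n) =
     (fun n => \sum_l pseries (coef 0 i l) t n * A l j).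
  apply/funext => n; rewrite /pseries /series /=.
  under eq_bigr do rewrite mulr_sumr.
  under [RHS]eq_bigr do rewrite mulr_suml.
  rewrite exchange_big [RHS]exchange_big; apply: eq_bigr => k _.
  rewrite /coef addn0.
  transitivity (k`!%:R^-1 * t ^+ k * (A ^+ k.+1) i j).
    by rewrite exprS mxE mulr_sumr; apply: eq_bigr => l _; ring.
  by rewrite exprSr mxE mulr_sumr; apply: eq_bigr => l _; ring.
have C1 : (fun n => \sum_l A i l * pseries (coef 0 l j) t n) @ \oo -->
    \sum_l A i l * limn (pseries (coef 0 l j) t).
  by apply: cvg_sum_fin => l; apply: cvgMl_tmp; exact: cvg_coef.
have C2 : (fun n => \sum_l pseries (coef 0 i l) t n * A l j) @ \oo -->
    \sum_l limn (pseries (coef 0 i l) t) * A l j.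
  by apply: cvg_sum_fin => l; apply: cvgMr_tmp; exact: cvg_coef.
by rewrite -(cvg_lim _ C1) // -(cvg_lim _ C2) // E.
Qed.

Lemma expm0 : expm (0 *: A) = 1%:M.
Proof.
apply/matrixP => i j; rewrite expm_coord; apply/cvg_lim => //.
(* The partial sums are constant only from rank 1 on; the one of rank 0 is empty. *)
rewrite -(cvg_shiftn 1); apply: cvg_near_cst; apply: nearW => n.
rewrite /pseries /series /= addn1 big_nat_recl //= big1 ?addr0.
  by rewrite /coef expr0 mulr1 fact0 invr1 mul1r.
by move=> k _; rewrite expr0n mulr0.
Qed.

End MatrixExponential.

(** * Chain rule from continuous partial derivatives *)

Section ChainRule.
Variables (R : realType) (K : nat).
Notation V := 'cV[R]_K.
Notation e j := (delta_mx j ord0 : V).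

Lemma mean_value0 (g dg : R -> R) (b : R) :
  (forall x : R, `|x| <= `|b| -> is_derive x 1 g (dg x)) ->
  exists2 c, `|c| <= `|b| & g b - g 0 = dg c * b.
Proof.
move=> H.
have [b0|b0] := leP 0 b.
  have [x||c + ->] := @MVT_segment _ g dg 0 b b0.
  - by rewrite in_itv /= => /andP[x0 xb]; apply: H; rewrite !ger0_norm // ltW.
  - apply: derivable_within_continuous => x.
    rewrite in_itv /= => /andP[x0 xb].
    by have [] : is_derive x 1 g (dg x) by apply: H; rewrite !ger0_norm.
  by rewrite in_itv /= subr0 => /andP[c0 cb]; exists c; rewrite // !ger0_norm.
have [x||c + E] := @MVT_segment _ g dg b 0 (ltW b0).
- rewrite in_itv /= => /andP[x0 xb]; apply: H.
  by rewrite !ler0_norm // ?lerN2; exact: ltW.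
- apply: derivable_within_continuous => x.
  rewrite in_itv /= => /andP[x0 xb].
  by have [] : is_derive x 1 g (dg x) by apply: H; rewrite !ler0_norm ?lerN2 // ltW.
rewrite in_itv /= => /andP[c0 cb]; exists c.
  by rewrite !ler0_norm ?lerN2 // ltW.
by rewrite -opprB E sub0r mulrN opprK.
Qed.

Lemma is_derive_line (W : normedModType R) (f : V -> W) x v (t : R) df :
  is_derive (x + t *: v) v f df -> is_derive t 1 (fun s => f (x + s *: v)) df.
Proof.
have E : (fun h : R => h^-1 *: (((fun s => f (x + s *: v)) \o shift t) (h *: 1) - f (x + t *: v))) =
     (fun h : R => h^-1 *: ((f \o shift (x + t *: v)) (h *: v) - f (x + t *: v))).
  apply/funext => h /=; congr (_ *: (f _ - _)).
  by rewrite scalerDl addrCA /GRing.scale /= mulr1.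
case=> D V0; apply: DeriveDef; first by rewrite /derivable E.
by rewrite -V0 /derive E.
Qed.

Lemma is_derive_of_line (W : normedModType R) (f : V -> W) x v df :
  is_derive (0 : R) 1 (fun s => f (x + s *: v)) df -> is_derive x v f df.
Proof.
have E : (fun h : R => h^-1 *: (((fun s => f (x + s *: v)) \o shift (0 : R)) (h *: 1) - f (x + (0 : R) *: v))) =
     (fun h : R => h^-1 *: ((f \o shift x) (h *: v) - f x)).
  apply/funext => h /=; rewrite scale0r !addr0; congr (_ *: (f _ - _)).
  by rewrite addrC /GRing.scale /= mulr1.
case=> D V0; apply: DeriveDef; first by rewrite /derivable -E.
by rewrite -V0 /derive -E.
Qed.

(** [smooth_on] provides directional derivatives only, so differentiability is derived from
    continuity of the partials: [h] is added one coordinate at a time, and each increment is a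
    one-variable mean value. *)
Lemma partials_remainder (f : V -> R) x (eps : R) : 0 < eps ->
  (forall j, \forall y \near x, derivable f y (e j)) ->
  (forall j, {for x, continuous ('D_(e j) f)}) ->
  \forall h \near (0 : V),
    `|f (x + h) - f x - \sum_j h j ord0 * 'D_(e j) f x| <= K%:R * (eps * `|h|).
Proof.
move=> eps0 Df Cf.
have : \forall y \near x, forall j : 'I_K, derivable f y (e j) /\
     `|'D_(e j) f x - 'D_(e j) f y| <= eps.
  apply: (@filter_forall _ _ (fun j y => derivable f y (e j) /\
     `|'D_(e j) f x - 'D_(e j) f y| <= eps) (nbhs x)) => j.
  apply: filterI; first exact: Df.
  by move/cvgrPdist_le : (Cf j); apply.
move=> /nbhs_ballP[r /= r0 Hr].
apply/nbhs_ballP; exists r => //= h; rewrite -ball_normE /= sub0r normrN => hr.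
(* Truncation of [h] to its first [k] coordinates. In the sup norm it is no longer than [h], so the
   intermediate points stay in the ball. *)
pose hk (k : nat) : V := \col_j (if (j < k)%N then h j ord0 else 0).
have hk0 : hk 0%N = 0 by apply/colP => j; rewrite !mxE.
have hkK : hk K = h by apply/colP => j; rewrite !mxE ltn_ord.
have -> : f (x + h) - f x = \sum_(k < K) (f (x + hk k.+1) - f (x + hk k)).
  rewrite -(big_mkord xpredT (fun k => f (x + hk k.+1) - f (x + hk k))).
  by rewrite telescope_sumr // hkK hk0 addr0.
rewrite -sumrB; apply: le_trans (ler_norm_sum _ _ _) _.
rewrite mulr_natl -[X in _ *+ X](card_ord K) -sumr_const; apply: ler_sum => k _.
have hkS : hk k.+1 = hk k + h k ord0 *: e k.
  apply/colP => j; rewrite !mxE eqxx andbT ltnS leq_eqVlt.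
  have [->|jk] := eqVneq j k; first by rewrite eqxx ltnn /= add0r mulr1.
  by rewrite (inj_eq val_inj) (negbTE jk) /= mulr0 addr0.
have inr c : `|c| <= `|h k ord0| -> ball x r (x + hk k + c *: e k).
  move=> ch; rewrite -ball_normE /= -addrA opprD addNKr normrN.
  apply: le_lt_trans hr; apply: mx_norm_le => // i j; rewrite !mxE.
  have [->|ik] := eqVneq i k; rewrite ?ltnn /=.
    by rewrite add0r ord1 eqxx mulr1; apply: le_trans ch _; exact: norm_coord_le.
  rewrite mulr0 addr0; case: ifP => _; rewrite ?normr0 //; exact: norm_coord_le.
have [s sh|c ch E] := @mean_value0 (fun s => f (x + hk k + s *: e k))
   (fun s => 'D_(e k) f (x + hk k + s *: e k)) (h k ord0).
  apply: is_derive_line; apply: derivableP.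
  by have [] := Hr _ (inr _ sh) k.
move: E; rewrite scale0r addr0 -addrA -hkS => ->.
rewrite [X in X - _]mulrC -mulrBr normrM mulrC.
have [_] := Hr _ (inr _ ch) k; rewrite distrC => Hk.
by apply: ler_pM => //; exact: norm_coord_le.
Qed.

Lemma chain_partials (f : V -> R) (g : R -> V) (s : R) dg :
  (forall j, \forall y \near g s, derivable f y (e j)) ->
  (forall j, {for g s, continuous ('D_(e j) f)}) ->
  is_derive s 1 g dg ->
  is_derive s 1 (fun t => f (g t)) (\sum_j dg j ord0 * 'D_(e j) f (g s)).
Proof.
move=> Df Cf Dg; set L := fun h : V => \sum_j h j ord0 * 'D_(e j) f (g s).
have gc := is_derive_continuous Dg.
case: (Dg) => Dg1 Dg2.
have qc : (fun h : R => h^-1 *: (g (h + s) - g s)) @ 0^' --> dg.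
  move: (Dg1) => /cvg_ex[l Hl].
  have E : (fun h : R => h^-1 *: ((g \o shift s) (h *: (1 : R)) - g s)) =
     (fun h : R => h^-1 *: (g (h + s) - g s)).
    by apply/funext => h /=; rewrite /GRing.scale /= mulr1.
  have <- : l = dg by rewrite -Dg2 /derive; apply/esym/cvg_lim.
  by rewrite -E.
have main : (fun h : R => h^-1 *: (f (g (h + s)) - f (g s))) @ 0^' --> L dg.
  have Lc : (fun h : R => L (h^-1 *: (g (h + s) - g s))) @ 0^' --> L dg.
    apply: cvg_sum_fin => j; apply: cvgMr_tmp.
    exact: (cvg_comp _ _ qc (@coord_continuous R K 1 j ord0 dg)).
  apply: cvg_sub0 Lc; apply/cvgr0Pnorm_le => eps eps0 /=.
  (* Chosen so that [(K + 1) * eta * (|dg| + 1) = eps], where [|dg| + 1] bounds the difference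
     quotients of [g] near [s]. *)
  pose eta := eps / (K%:R + 1) / (`|dg| + 1).
  have K1 : 0 < K%:R + 1 :> R by rewrite ltr_wpDl.
  have g1 : 0 < `|dg| + 1 by rewrite ltr_wpDl.
  have eta0 : 0 < eta by rewrite !divr_gt0.
  have P := partials_remainder eta0 Df Cf.
  have gs0 : (fun h : R => g (h + s) - g s) @ 0^' --> (0 : V).
    apply: cvg_trans (_ : (fun h : R => g (h + s) - g s) @ 0 --> (0 : V)).
      exact: cvg_app (@nbhs_dnbhs _ 0).
    have sc : (fun h : R => h + s) @ 0 --> s.
      have : (fun h : R => h + s) @ 0 --> 0 + s.
        by apply: cvgD; [exact: cvg_id | exact: cvg_cst].
      by rewrite add0r.
    by apply/subr_cvg0; exact: (cvg_comp _ _ sc gc).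
  near=> h.
  have h0 : h != 0 by near: h; exact: nbhs_dnbhs_neq.
  have Hq : `|h^-1 *: (g (h + s) - g s)| <= `|dg| + 1.
    rewrite -(subrK dg (h^-1 *: _)) (le_trans (ler_normD _ _)) // addrC lerD2l distrC.
    by near: h; move/cvgrPdist_le : qc; apply.
  have Hp : `|f (g s + (g (h + s) - g s)) - f (g s) - L (g (h + s) - g s)| <=
            K%:R * (eta * `|g (h + s) - g s|).
    by near: h; exact: (gs0 _ P).
  rewrite [g s + _]addrC subrK in Hp.
  rewrite -[X in `|X|]/(h^-1 *: (f (g (h + s)) - f (g s)) - L (h^-1 *: (g (h + s) - g s))).
  have -> : L (h^-1 *: (g (h + s) - g s)) = h^-1 * L (g (h + s) - g s).
    by rewrite /L mulr_sumr; apply: eq_bigr => j _; rewrite mxE mulrA.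
  rewrite /GRing.scale /= -mulrBr normrM normfV.
  rewrite ler_pdivrMl ?normr_gt0 //; apply: le_trans Hp _.
  have Hq' : `|g (h + s) - g s| <= `|h| * (`|dg| + 1).
    by move: Hq; rewrite normrZ normfV ler_pdivrMl ?normr_gt0.
  apply: (@le_trans _ _ ((K%:R + 1) * (eta * (`|h| * (`|dg| + 1))))).
    apply: ler_pM => //; first by rewrite mulr_ge0 // ltW.
      by rewrite lerDl.
    by rewrite ler_pM2l.
  rewrite /eta le_eqVlt; apply/orP; left; apply/eqP; field.
  by rewrite !gt_eqF.
have E : (fun h : R => h^-1 *: (((fun t => f (g t)) \o shift s) (h *: (1 : R)) - f (g s))) =
     (fun h : R => h^-1 *: (f (g (h + s)) - f (g s))).
  by apply/funext => h /=; rewrite [h *: 1]mulr1.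
apply: DeriveDef; first by rewrite /derivable E; apply/cvg_ex; exists (L dg).
by rewrite /derive E; apply/cvg_lim.
Unshelve. all: by end_near. Qed.

End ChainRule.

(** * Tangent vectors of a level set *)

(** Joins completeness to the normed structure of matrices, for the fixed point argument in
    [newton_zero]. *)
HB.instance Definition _ (R : realType) m n :=
  Uniform_isComplete.Build 'M[R]_(m, n) (@cauchy_cvg _).

Lemma norm_mulmx_le (R : realType) m n p (A : 'M[R]_(m, n)) (B : 'M[R]_(n, p)) :
  `|A *m B| <= n%:R * (`|A| * `|B|).
Proof.
apply: mx_norm_le => [|i j]; first by rewrite !mulr_ge0.
rewrite mxE; apply: le_trans (ler_norm_sum _ _ _) _.
rewrite mulr_natl -[X in _ *+ X](card_ord n) -sumr_const; apply: ler_sum => k _.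
by rewrite normrM; apply: ler_pM => //; exact: norm_coord_le.
Qed.

Lemma norm_dotv_le (R : realType) n (v w : 'cV[R]_n) :
  `|dotv v w| <= n%:R * (`|v| * `|w|).
Proof.
apply: le_trans (norm_coord_le _ _ _) _; apply: le_trans (norm_mulmx_le _ _) _.
rewrite ler_wpM2l // ler_wpM2r //; apply: mx_norm_le => // i j.
by rewrite mxE; exact: norm_coord_le.
Qed.

Lemma is_derive_affine (R : realType) (W : normedModType R) (x v : W) (t : R) :
  is_derive t 1 (fun s => x + s *: v) v.
Proof.
have D : is_derive t 1 ((cst x : R -> W) + (fun s : R => s *: v)) (0 + (1 : R) *: v).
  apply: is_deriveD.
  apply: DeriveDef; first by apply/derivable1_diffP.
  by rewrite deriveE // diff_val.
by rewrite add0r scale1r in D.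
Qed.

Section Jacobian.
Variables (R : realType) (K : nat).
Notation V := 'cV[R]_K.
Notation e j := (delta_mx j ord0 : V).

Definition jac c (F : V -> 'cV[R]_c) (x : V) : 'M[R]_(c, K) :=
  \matrix_(i, j) ('D_(e j) F x) i ord0.

Lemma dirder_cat c (vs ws : seq V) (F : V -> 'cV[R]_c) :
  dirder (vs ++ ws) F = dirder vs (dirder ws F).
Proof. by elim: vs => //= v vs ->. Qed.

Lemma smooth_on_dirder c U (F : V -> 'cV[R]_c) ws :
  smooth_on U F -> smooth_on U (dirder ws F).
Proof. by move=> H vs; rewrite -dirder_cat; exact: H. Qed.

Section Smooth.
Variables (c : nat) (U : set V) (F : V -> 'cV[R]_c).
Hypotheses (oU : open U) (sF : smooth_on U F).

Lemma is_derive_smooth_comp (g : R -> V) (s : R) dg : U (g s) ->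
  is_derive s 1 g dg -> is_derive s 1 (fun t => F (g t)) (jac F (g s) *m dg).
Proof.
move=> Ug Dg; apply/is_derive_mxP => i j; rewrite mxE.
have Ec x k : U x -> 'D_(e k) (fun y => F y i ord0) x = 'D_(e k) F x i ord0.
  by move=> Ux; rewrite (derive_mx ((sF [::]).1 x Ux _)) mxE.
have nU : \forall y \near g s, U y by exact: open_nbhs_nbhs.
have := @chain_partials _ _ (fun y => F y i ord0) g s dg _ _ Dg.
rewrite (ord1 j); under eq_bigr do rewrite Ec // mulrC.
move=> H; under eq_bigr do rewrite mxE; apply: H => k.
  apply: filterS nU => y Uy.
  by have /derivable_mxP := (sF [::]).1 y Uy (e k); apply.
have C : {for g s, continuous (fun y => 'D_(e k) F y i ord0)}.
  exact: (cvg_comp _ _ ((sF [:: e k]).2 _ Ug)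
           (@coord_continuous R c 1 i ord0 ('D_(e k) F (g s)))).
have E : {near g s, (fun y => 'D_(e k) F y i ord0) =1
    'D_(e k) (fun y => F y i ord0)}.
  by apply: filterS nU => y Uy; rewrite Ec.
rewrite /prop_for /continuous_at Ec //.
exact: cvg_trans (near_eq_cvg E) C.
Qed.

Lemma is_derive_smooth x v : U x -> is_derive x v F (jac F x *m v).
Proof.
move=> Ux; apply: is_derive_of_line.
have := @is_derive_smooth_comp (fun s => x + s *: v) 0 v.
rewrite scale0r addr0; apply => //.
exact: is_derive_affine.
Qed.

Lemma jac_continuous x : U x -> {for x, continuous (jac F)}.
Proof.
move=> Ux; apply: (@cvg_mx R _ (nbhs x) _) => i j; rewrite mxE; under eq_fun do rewrite mxE.
exact: (cvg_comp _ _ ((sF [:: e j]).2 _ Ux)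
         (@coord_continuous R c 1 i ord0 ('D_(e j) F x))).
Qed.

Lemma jac_surj x : U x -> (forall w, exists v, 'D_v F x = w) ->
  exists L : 'M[R]_(K, c), jac F x *m L = 1%:M.
Proof.
move=> Ux S.
have /choice[v Hv] : forall j : 'I_c, exists v : V, jac F x *m v = delta_mx j ord0.
  move=> j; have [v <-] := S (delta_mx j ord0); exists v.
  by have [_ ->] := is_derive_smooth v Ux.
exists (\matrix_(i, j) v j i ord0); apply/matrixP => i j.
have /colP/(_ i) := Hv j; rewrite [RHS]mxE eqxx andbT => H.
by rewrite [RHS]mxE -H !mxE; apply: eq_bigr => k _; rewrite !mxE.
Qed.

(** Continuity of the Jacobian keeps [jac F z *m L] close to the identity; [D] collects the
    dimension factors that products cost in the sup norm. *)
Lemma jac_near_right_inverse x (L : 'M[R]_(K, c)) : U x ->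
  jac F x *m L = 1%:M ->
  \forall z \near x, forall y : 'cV[R]_c, `|y - jac F z *m (L *m y)| <= 2^-1 * `|y|.
Proof.
move=> Ux JL.
pose D := c%:R * (K%:R * (`|L| + 1)) + 1.
have D0 : 0 < D by rewrite ltr_wpDl // !mulr_ge0 // addr_ge0.
have e0 : 0 < (2 * D)^-1 by rewrite invr_gt0 mulr_gt0.
move/cvgrPdist_le : (jac_continuous Ux) => /(_ _ e0).
apply: filterS => z Hz y.
have -> : y - jac F z *m (L *m y) = (jac F x - jac F z) *m L *m y.
  by rewrite mulmxBl JL mulmxBl mul1mx mulmxA.
apply: le_trans (norm_mulmx_le _ _) _; rewrite mulrA; apply: ler_wpM2r => //.
apply: (@le_trans _ _ (c%:R * (K%:R * ((2 * D)^-1 * (`|L| + 1))))).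
  apply: ler_wpM2l => //; apply: le_trans (norm_mulmx_le _ _) _.
  by apply: ler_wpM2l => //; apply: ler_pM => //; rewrite lerDl.
rewrite invfM [leLHS](_ : _ = 2^-1 * ((c%:R * (K%:R * (`|L| + 1))) / D)); last by ring.
by rewrite ler_piMr // ler_pdivrMr // mul1r lerDl.
Qed.

(** Newton's method with a frozen right inverse [L]: the map [y - F (b + L y)] contracts by 1/2, and
    its fixed points are the zeros sought. The correction is bounded by the defect [|F b|], which
    [kernel_tangent] exploits. *)
Lemma newton_zero (L : 'M[R]_(K, c)) (x b : V) (r : R) :
  (forall z, ball x r z -> U z /\
    forall y : 'cV[R]_c, `|y - jac F z *m (L *m y)| <= 2^-1 * `|y|) ->
  (forall y : 'cV[R]_c, `|y| <= 2 * `|F b| -> ball x r (b + L *m y)) ->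
  exists2 y : 'cV[R]_c, `|y| <= 2 * `|F b| & F (b + L *m y) = 0.
Proof.
move=> near_x in_ball; set a := `|F b|.
pose A := [set y : 'cV[R]_c | `|y| <= 2 * a].
pose Phi (y : 'cV[R]_c) := y - F (b + L *m y).
(* For the sup norm it suffices to apply the mean value theorem to each entry along the segment from
   [y'] to [y]. *)
have lip y y' : A y -> A y' -> `|Phi y - Phi y'| <= 2^-1 * `|y - y'|.
  move=> Ay Ay'; apply: mx_norm_le => [|i j]; first by rewrite mulr_ge0 // invr_ge0.
  pose g t := Phi (y' + t *: (y - y')) i j.
  pose pt t := b + L *m (y' + t *: (y - y')).
  pose dg t := ((y - y') - jac F (pt t) *m (L *m (y - y'))) i j.
  have inA (t : R) : 0 <= t <= 1 -> A (y' + t *: (y - y')).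
    move=> /andP[t0 t1]; rewrite /A /=.
    rewrite (_ : _ + _ = (1 - t) *: y' + t *: y); last first.
      by apply/matrixP => k l; rewrite !mxE; ring.
    apply: le_trans (ler_normD _ _) _; rewrite !normrZ (ger0_norm t0).
    rewrite ger0_norm ?subr_ge0 // (_ : 2 * a = (1 - t) * (2 * a) + t * (2 * a)).
      by rewrite lerD // ler_wpM2l // subr_ge0.
    by ring.
  have Dg (t : R) : 0 <= t <= 1 -> is_derive t 1 g (dg t).
    move=> t01; have [Uz _] := near_x _ (in_ball _ (inA t t01)).
    have D1 := is_derive_affine y' (y - y') t.
    have D2 : is_derive t 1 pt (L *m (y - y')).
      have := is_deriveD (is_derive_cst b t (1 : R)) (is_derive_mulmxl L D1).
      by rewrite add0r.
    have D3 := is_derive_smooth_comp Uz D2.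
    have := is_deriveB D1 D3 => /is_derive_mxP /(_ i j).
    by [].
  have [t||t] := @MVT_segment _ g dg 0 1 ler01.
  - by rewrite in_itv /= => /andP[t0 t1]; apply: Dg; rewrite !ltW.
  - apply: derivable_within_continuous => t.
    by rewrite in_itv /= => t01; have [] := Dg t t01.
  rewrite in_itv /= subr0 mulr1 => t01 E.
  have -> : (Phi y - Phi y') i j = g 1 - g 0.
    by rewrite /g scale1r [y' + (y - y')]addrC subrK scale0r addr0 !mxE.
  rewrite E; apply: le_trans (norm_coord_le _ _ _) _.
  by have [_] := near_x _ (in_ball _ (inA t t01)); apply.
have a0 : 0 <= a by exact: normr_ge0.
have A0 : A 0 by rewrite /A /= normr0 mulr_ge0.
have Phi0 : `|Phi 0| = a by rewrite /Phi mulmx0 addr0 sub0r normrN.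
(* [|Phi y| <= |Phi 0| + |y| / 2 <= a + a], whence the radius [2 * a]. *)
have self : {homo Phi : y / A y >-> A y}.
  move=> y Ay; rewrite /A /= -(subrK (Phi 0) (Phi y)).
  apply: le_trans (ler_normD _ _) _; rewrite Phi0.
  have := lip _ _ Ay A0; rewrite subr0; move: Ay; rewrite /A /=; lra.
have Acl : closed A.
  apply: (closed_comp (f := fun y : 'cV[R]_c => `|y|)) (@closed_le _ (2 * a)).
  by move=> y _; exact: norm_continuous.
have h0 : 0 <= 2^-1 :> R by rewrite invr_ge0.
have [] := @banach_fixed_point R 'cV[R]_c A (mkfun self) _ Acl.
- exists (NngNum h0); split => /=; first by rewrite invf_lt1 // ltr1n.
  by move=> [y y'] [/= Ay Ay']; exact: lip.
- by exists 0.
move=> y Ay E; have {}E : y = y - F (b + L *m y) := E; exists y => //.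
by rewrite -[LHS](subKr y) -E subrr.
Qed.

(** As [v] is in the kernel, [F (x + s v) = o(s)], so the Newton correction that brings [x + s v]
    back to [M] is [o(s)] too, and the corrected curve has velocity [v] at 0. *)
Lemma kernel_tangent (M : set V) x v : U x -> F x = 0 ->
  (forall y, U y -> (M y <-> F y = 0)) ->
  (exists L : 'M[R]_(K, c), jac F x *m L = 1%:M) ->
  jac F x *m v = 0 -> tangent_vec M x v.
Proof.
move=> Ux Fx0 MF [L JL] Jv.
have [r /= r0 Hr] : exists2 r : R, 0 < r & forall z, ball x r z -> U z /\
    forall y : 'cV[R]_c, `|y - jac F z *m (L *m y)| <= 2^-1 * `|y|.
  have : \forall z \near x, U z /\
      forall y : 'cV[R]_c, `|y - jac F z *m (L *m y)| <= 2^-1 * `|y|.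
    by apply: filterI; [exact: open_nbhs_nbhs | exact: jac_near_right_inverse].
  by move=> /nbhs_ballP[r /= r0 Hr]; exists r.
pose l := c%:R * `|L| * 2.
have l0 : 0 <= l by rewrite !mulr_ge0.
have /choice[gam Hg] : forall s : R, exists z, M z /\
   (`|s *: v| + l * `|F (x + s *: v)| < r ->
    `|z - (x + s *: v)| <= l * `|F (x + s *: v)|).
  move=> s; have [h|h] := ltP (`|s *: v| + l * `|F (x + s *: v)|) r; last first.
    by exists x; split => //; apply/MF.
  have Lb (y : 'cV[R]_c) : `|y| <= 2 * `|F (x + s *: v)| ->
      `|L *m y| <= l * `|F (x + s *: v)|.
    move=> Hy; apply: le_trans (norm_mulmx_le _ _) _.
    by rewrite /l -!mulrA ler_wpM2l // ler_wpM2l.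
  have bb (y : 'cV[R]_c) : `|y| <= 2 * `|F (x + s *: v)| ->
      ball x r (x + s *: v + L *m y).
    move=> Hy; rewrite -ball_normE /= -addrA opprD addNKr normrN.
    apply: le_lt_trans h; apply: le_trans (ler_normD _ _) _.
    by rewrite lerD2l; exact: Lb.
  have [y Hy Fy] := newton_zero Hr bb.
  exists (x + s *: v + L *m y); split; last by rewrite addrAC subrr add0r => _; exact: Lb.
  by apply/MF => //; have [] := Hr _ (bb y Hy).
have g0 : gam 0 = x.
  have [_] := Hg 0; rewrite scale0r addr0 Fx0 !normr0 mulr0 addr0 => /(_ r0).
  by rewrite normr_le0 subr_eq0 => /eqP.
have [DF1 DF2] := is_derive_smooth v Ux.
rewrite Jv in DF2.
have quot : (fun h : R => h^-1 *: (F (x + h *: v))) @ 0^' --> (0 : 'cV[R]_c).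
  move: DF1 => /cvg_ex[w Hw].
  have w0 : w = 0 by rewrite -DF2 /derive; apply/esym/cvg_lim.
  rewrite w0 in Hw; rewrite (_ : (fun _ => _) =
    (fun h : R => h^-1 *: ((F \o shift x) (h *: v) - F x))) //.
  by apply/funext => h /=; rewrite Fx0 subr0 addrC.
have dgam : (fun h : R => h^-1 *: (gam h - x)) @ 0^' --> v.
  apply: cvg_sub0 (cvg_cst v); apply/cvgr0Pnorm_le => eps eps0 /=.
  pose d := eps / (l + 1).
  have d0 : 0 < d by rewrite divr_gt0 // ltr_wpDl.
  (* With this [m], [|h| < r / m] places [x + h v] in the range where the correction is
     available. *)
  pose m := `|v| + l * d + 1.
  have m0 : 0 < m by rewrite ltr_wpDl // addr_ge0 // mulr_ge0 // ltW.
  near=> h.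
  have h0 : h != 0 by near: h; exact: nbhs_dnbhs_neq.
  have hs : `|h| < r / m by near: h; apply: dnbhs0_lt; rewrite divr_gt0.
  have Hq : `|F (x + h *: v)| <= d * `|h|.
    have : `|h^-1 *: F (x + h *: v)| <= d.
      by near: h; move/cvgr0Pnorm_le : quot; apply.
    by rewrite normrZ normfV ler_pdivrMl ?normr_gt0 // mulrC.
  rewrite -[X in `|X|]/(h^-1 *: (gam h - x) - v).
  have -> : h^-1 *: (gam h - x) - v = h^-1 *: (gam h - (x + h *: v)).
    by rewrite opprD addrA [in RHS]scalerBr scalerA mulVf // scale1r.
  rewrite normrZ normfV ler_pdivrMl ?normr_gt0 //.
  have [_ H] := Hg h; apply: le_trans (H _) _.
    rewrite normrZ; apply: (@le_lt_trans _ _ (`|h| * m)); last by rewrite -ltr_pdivlMr.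
    apply: (@le_trans _ _ (`|h| * `|v| + l * (d * `|h|))).
      by rewrite lerD2l ler_wpM2l.
    by rewrite /m; have := normr_ge0 h; nra.
  apply: (@le_trans _ _ (l * (d * `|h|))); first by rewrite ler_wpM2l.
  rewrite mulrA mulrC ler_wpM2l // /d mulrA ler_pdivrMr ?ltr_wpDl //.
  by rewrite mulrDr mulr1 mulrC lerDl ltW.
have E : (fun h : R => h^-1 *: (gam h - x)) =
    (fun h : R => h^-1 *: ((gam \o shift (0 : R)) (h *: (1 : R)) - gam 0)).
  by apply/funext => h /=; rewrite g0 addr0 [h *: 1]mulr1.
rewrite E in dgam; exists gam; split => //; first by move=> s; have [] := Hg s.
  by apply/cvg_ex; exists v.
by rewrite derive1E /derive; apply/cvg_lim.
Unshelve. all: by end_near. Qed.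

End Smooth.
End Jacobian.

(** * Normal curvature of a compact submanifold *)

Lemma dotvC (R : realType) n (v w : 'cV[R]_n) : dotv v w = dotv w v.
Proof. by rewrite /dotv -[w in LHS]trmxK -trmx_mul mxE. Qed.

Lemma dotvBl (R : realType) n (u v w : 'cV[R]_n) :
  dotv (u - v) w = dotv u w - dotv v w.
Proof. by rewrite /dotv linearB /= mulmxBl !mxE. Qed.

Lemma dotvDr (R : realType) n (u v w : 'cV[R]_n) :
  dotv u (v + w) = dotv u v + dotv u w.
Proof. by rewrite /dotv mulmxDr mxE. Qed.

Lemma dotvZr (R : realType) n (v w : 'cV[R]_n) k : dotv v (k *: w) = k * dotv v w.
Proof. by rewrite /dotv -scalemxAr mxE. Qed.

Lemma dotvBr (R : realType) n (u v w : 'cV[R]_n) :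
  dotv u (v - w) = dotv u v - dotv u w.
Proof. by rewrite dotvC dotvBl !(dotvC _ u). Qed.

(** A kernel vector would satisfy [|y| <= |y| / 2]. The transposes appear because [kermx] is a left
    kernel. *)
Lemma unitmx_near1 (R : realType) c (A : 'M[R]_c) :
  (forall y : 'cV[R]_c, `|y - A *m y| <= 2^-1 * `|y|) -> A \in unitmx.
Proof.
move=> HA.
have inj (y : 'cV[R]_c) : A *m y = 0 -> y = 0.
  move=> Ay; have := HA y; rewrite Ay subr0 => Hy.
  by apply/eqP; rewrite -normr_le0; lra.
rewrite -unitmx_tr -row_free_unit -kermx_eq0; apply/eqP.
have H : A *m (kermx A^T)^T = 0.
  by apply: trmx_inj; rewrite trmx_mul trmxK mulmx_ker trmx0.
suff H2 : (kermx A^T)^T = 0 by rewrite -[kermx _]trmxK H2 trmx0.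
apply/matrixP => i j; rewrite [RHS]mxE.
have E : A *m col j (kermx A^T)^T = 0 by rewrite colE mulmxA H mul0mx.
by have /colP/(_ i) := inj _ E; rewrite !mxE.
Qed.

Section Curvature.
Variables (R : realType) (K : nat).
Notation V := 'cV[R]_K.
Notation e j := (delta_mx j ord0 : V).

Section Local.
Variables (M : set V) (c : nat) (U : set V) (F : V -> 'cV[R]_c).
Hypotheses (oU : open U) (sF : smooth_on U F).
Hypothesis MF : forall x, U x -> (M x <-> F x = 0).

(** Obtained by differentiating [F (g s) = 0] twice; the right-hand side is minus the Hessian of [F]
    evaluated twice on [g1 0]. *)
Lemma curve_second_derivative (g g1 : R -> V) (w : V) :
  (forall s, M (g s)) -> (forall s : R, is_derive s 1 g (g1 s)) ->
  is_derive (0 : R) 1 g1 w -> U (g 0) ->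
  jac F (g 0) *m w =
    - \sum_j g1 0 j ord0 *: (jac ('D_(e j) F) (g 0) *m g1 0).
Proof.
move=> Mg Dg Dg1 U0.
have gc : g @ (0 : R) --> g 0 by exact: is_derive_continuous (Dg 0).
have nU : \forall s \near (0 : R), U (g s) by apply: gc; exact: open_nbhs_nbhs.
have Z : {near (0 : R), (fun=> 0) =1 (fun s => jac F (g s) *m g1 s)}.
  move: (nU) => /nbhs_ballP[r /= r0 Hr]; apply/nbhs_ballP; exists r => //= s sr.
  have [_ <-] := is_derive_smooth_comp oU sF (Hr _ sr) (Dg s).
  have [_ <-] := is_derive_cst (0 : 'cV[R]_c) s (1 : R).
  apply: near_eq_derive.
  have : \forall t \near s, ball (0 : R) r t.
    by apply: open_nbhs_nbhs; split => //; exact: ball_open.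
  by apply: filterS => t tr; apply/esym/MF => //; exact: Hr.
pose dJ : 'M[R]_(c, K) := \matrix_(i, j) (jac ('D_(e j) F) (g 0) *m g1 0) i ord0.
have DJ : is_derive (0 : R) 1 (fun s => jac F (g s)) dJ.
  apply/is_derive_mxP => i j; rewrite mxE; under eq_fun do rewrite mxE.
  have := is_derive_smooth_comp oU (smooth_on_dirder [:: e j] sF) U0 (Dg 0).
  by move=> /is_derive_mxP; apply.
have [_ D1] := is_derive_mulmx DJ Dg1.
have [_ D0] := is_derive_cst (0 : 'cV[R]_c) (0 : R) (1 : R).
have : dJ *m g1 0 + jac F (g 0) *m w = 0.
  rewrite -D1 -D0; apply/esym; exact: near_eq_derive Z.
move=> /eqP; rewrite addrC addr_eq0 => /eqP ->; congr (- _).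
apply/colP => i; rewrite !mxE summxE; apply: eq_bigr => j _.
by rewrite !mxE mulrC.
Qed.

(** Subtracting from [w] a vector [L y] with the same image under the Jacobian leaves a kernel
    vector, which is tangent and so orthogonal to [n]. Hence [<n, w> = <n, L y>], and [y] is
    controlled by [jac F x *m w], which is quadratic in the velocity. *)
Lemma normal_curvature_local p : U p ->
  (exists L : 'M[R]_(K, c), jac F p *m L = 1%:M) ->
  exists C, 0 <= C /\ \forall x \near p, forall (g g1 : R -> V) (w n : V),
    g 0 = x -> (forall s, M (g s)) -> (forall s : R, is_derive s 1 g (g1 s)) ->
    is_derive (0 : R) 1 g1 w -> normal_to M x n ->
    `|dotv n w| <= C * (`|n| * `|g1 0| ^+ 2).
Proof.
move=> Up [L JL].
have Bex j : exists B, 0 <= B /\ \forall x \near p, `|jac ('D_(e j) F) x| <= B.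
  have /cvgrPdist_le/(_ _ ltr01) := jac_continuous (smooth_on_dirder [:: e j] sF) Up.
  move=> H; exists (1 + `|jac ('D_(e j) F) p|); split; first by rewrite addr_ge0.
  apply: filterS H => x /= Hx; rewrite -lerBlDr.
  by apply: le_trans (lerB_dist _ _) _; rewrite distrC.
have [Bj HB] := choice Bex.
pose q := \sum_j (K%:R * Bj j).
have q0 : 0 <= q by apply: sumr_ge0 => j _; rewrite mulr_ge0 //; have [] := HB j.
exists (K%:R * (c%:R * `|L| * (2 * q))); split; first by rewrite !mulr_ge0.
have nB : \forall x \near p, forall j, `|jac ('D_(e j) F) x| <= Bj j.
  apply: (@filter_forall _ _ (fun j x => `|jac ('D_(e j) F) x| <= Bj j) (nbhs p)).
  by move=> j; have [] := HB j.
have nU : \forall x \near p, U x by exact: open_nbhs_nbhs.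
have nL := jac_near_right_inverse sF Up JL.
apply: filterS3 nB nU nL => x HBx Ux HLx.
move=> g g1 w n gx Mg Dg Dg1 Nn.
have U0 : U (g 0) by rewrite gx.
have Jw := curve_second_derivative Mg Dg Dg1 U0; rewrite gx in Jw.
set A := jac F x *m L.
have HA (y : 'cV[R]_c) : `|y - A *m y| <= 2^-1 * `|y| by rewrite -mulmxA.
have uA := unitmx_near1 HA.
set z := jac F x *m w in Jw.
have zq : `|z| <= q * `|g1 0| ^+ 2.
  rewrite Jw normrN; apply: le_trans (ler_norm_sum _ _ _) _.
  rewrite /q mulr_suml; apply: ler_sum => j _; rewrite normrZ.
  apply: (@le_trans _ _ (`|g1 0| * (K%:R * (Bj j * `|g1 0|)))).
    apply: ler_pM => //; first exact: norm_coord_le.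
    apply: le_trans (norm_mulmx_le _ _) _.
    by apply: ler_wpM2l => //; apply: ler_wpM2r.
  by rewrite le_eqVlt; apply/orP; left; apply/eqP; ring.
pose y := invmx A *m z.
have Ay : A *m y = z by rewrite mulKVmx.
have y2 : `|y| <= 2 * `|z|.
  have := HA y; rewrite Ay => H.
  have := ler_normD (y - z) z; rewrite subrK; lra.
have T : tangent_vec M x (w - L *m y).
  apply: (kernel_tangent oU sF) => //.
  - by apply/MF => //; rewrite -gx.
  - by exists (L *m invmx A); rewrite mulmxA mulmxV.
  - by rewrite mulmxBr mulmxA -/A Ay subrr.
have /eqP := Nn _ T; rewrite dotvBl subr_eq0 dotvC => /eqP ->; rewrite dotvC.
apply: le_trans (norm_dotv_le _ _) _; rewrite -!mulrA; apply: ler_wpM2l => //.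
rewrite [leRHS](_ : _ = `|n| * (c%:R * (`|L| * (2 * (q * `|g1 0| ^+ 2))))); last by ring.
apply: ler_wpM2l => //; apply: le_trans (norm_mulmx_le _ _) _.
apply: ler_wpM2l => //; apply: ler_wpM2l => //; apply: le_trans y2 _.
by apply: ler_wpM2l.
Qed.

End Local.

(** The local constants are made uniform by compactness in its near-covering form, with parameter
    [C] tending to infinity; the estimate survives enlarging [C]. *)
Theorem normal_curvature_bound (M : set V) : submanifold M -> compact M ->
  exists C, 0 <= C /\ forall (g g1 : R -> V) (w n : V),
    (forall s, M (g s)) -> (forall s : R, is_derive s 1 g (g1 s)) ->
    is_derive (0 : R) 1 g1 w -> normal_to M (g 0) n ->
    `|dotv n w| <= C * (`|n| * `|g1 0| ^+ 2).
Proof.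
move=> SM /compact_near_coveringP/near_covering_withinP cM.
pose P (C : R) (x : V) := forall (g g1 : R -> V) (w n : V),
    g 0 = x -> (forall s, M (g s)) -> (forall s : R, is_derive s 1 g (g1 s)) ->
    is_derive (0 : R) 1 g1 w -> normal_to M x n ->
    `|dotv n w| <= C * (`|n| * `|g1 0| ^+ 2).
have cov : forall p, M p -> \forall x \near p & C \near +oo, M x -> P C x.
  move=> p Mp; have [U [c [F [oU Up sF surj MF]]]] := SM p Mp.
  have [C [C0 HC]] := normal_curvature_local oU sF MF Up
     (jac_surj oU sF Up (surj p Up)).
  exists ([set x | P C x], [set D | C <= D]).
    by split => //; exact: (nbhs_pinfty_ge (num_real _)).
  move=> [x D] [/= HP CD] /= _ g g1 w n gx Mg Dg Dg1 Nn.
  apply: le_trans (HP g g1 w n gx Mg Dg Dg1 Nn) _.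
  by apply: ler_wpM2r => //; rewrite mulr_ge0 // exprn_ge0.
have H : \forall C \near +oo, M `<=` P C by exact: cM.
near (pinfty_nbhs R) => C.
exists C; split; first by near: C; exact: (nbhs_pinfty_ge (num_real _)).
have HC : M `<=` P C by near: C.
by move=> g g1 w n Mg; apply: (HC (g 0)).
Unshelve. all: by end_near. Qed.

End Curvature.

(** * Orthogonal matrices; integrals of continuous functions *)

Section LinearAlgebra.
Variables (R : realType) (K : nat).

Lemma sqnorm_ge0 (v : 'cV[R]_K) : 0 <= sqnorm v.
Proof.
by rewrite /sqnorm /dotv mxE; apply: sumr_ge0 => i _; rewrite mxE -expr2 sqr_ge0.
Qed.

Lemma sqnorm_coord (v : 'cV[R]_K) i j : (v i j) ^+ 2 <= sqnorm v.
Proof.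
rewrite /sqnorm /dotv mxE (bigD1 i) //= mxE ord1 expr2 lerDl.
by apply: sumr_ge0 => k _; rewrite mxE -expr2 sqr_ge0.
Qed.

Lemma norm_sqr_le_sqnorm (v : 'cV[R]_K) : `|v| ^+ 2 <= sqnorm v.
Proof.
rewrite -(sqr_sqrtr (sqnorm_ge0 v)) lerXn2r ?nnegrE ?sqrtr_ge0 //.
apply: mx_norm_le => [|i j]; first exact: sqrtr_ge0.
by rewrite -sqrtr_sqr ler_wsqrtr // sqnorm_coord.
Qed.

Lemma sqnorm_le (v : 'cV[R]_K) : sqnorm v <= K%:R * `|v| ^+ 2.
Proof.
by apply: le_trans (ler_norm _) _; rewrite expr2; exact: norm_dotv_le.
Qed.

Lemma sqnorm_eq0 (v : 'cV[R]_K) : sqnorm v <= 0 -> v = 0.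
Proof.
move=> v0; have := le_trans (norm_sqr_le_sqnorm v) v0.
by rewrite exprn_even_le0 //= normr_eq0 => /eqP.
Qed.

Lemma sqnorm_orth (h : 'M[R]_K) (v : 'cV[R]_K) :
  h^T *m h = 1%:M -> sqnorm (h *m v) = sqnorm v.
Proof.
by move=> hh; rewrite /sqnorm /dotv trmx_mul -mulmxA [h^T *m _]mulmxA hh mul1mx.
Qed.

(* [h - 1] is normal, so its kernel and image are complementary; [P] inverts
   [h - 1] on its image and [Q] projects onto its kernel. *)
Lemma orth_splitting (h : 'M[R]_K) : h^T *m h = 1%:M ->
  exists P Q : 'M[R]_K, forall x y : 'cV[R]_K,
    x = P *m (h *m x - x) + Q *m (x - (h *m y - y)).
Proof.
move=> hh; pose N := h - 1%:M.
have hN (x : 'cV[R]_K) : h *m x - x = N *m x by rewrite /N mulmxBl mul1mx.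
(* Tested on the cokernel [X] of [N *m N], the inclusion says that [N N X = 0] forces [N X = 0]. *)
have /submxP[P HP] : (N <= N *m N)%MS.
  rewrite submxE; apply/eqP; set X := cokermx _.
  have NNX : N *m (N *m X) = 0 by rewrite mulmxA mulmx_coker.
  set Y := N *m X in NNX *.
  have hY : h *m Y = Y.
    by apply/eqP; rewrite -subr_eq0; apply/eqP; rewrite -[RHS]NNX /N mulmxBl mul1mx.
  have hTY : h^T *m Y = Y by rewrite -[in LHS]hY mulmxA hh mul1mx.
  have NTY : N^T *m Y = 0.
    by rewrite /N linearB /= mulmxBl hTY trmx1 mul1mx subrr.
  have YY : Y^T *m Y = 0 by rewrite {1}/Y trmx_mul -mulmxA NTY mulmx0.
  apply/matrixP => i j; rewrite [RHS]mxE.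
  have Yj : col j Y = 0.
    apply: sqnorm_eq0; rewrite /sqnorm /dotv colE trmx_mul -mulmxA [Y^T *m _]mulmxA.
    by rewrite YY mul0mx mulmx0 mxE.
  by have /colP/(_ i) := Yj; rewrite !mxE.
exists P, (1%:M - P *m N) => x y; rewrite !hN.
have E : (1%:M - P *m N) *m N = 0 by rewrite mulmxBl mul1mx -mulmxA -HP subrr.
have -> : (1%:M - P *m N) *m (x - N *m y) = x - P *m (N *m x).
  by rewrite mulmxBr [X in _ - X]mulmxA E mul0mx subr0 mulmxBl mul1mx mulmxA.
by rewrite addrC subrK.
Qed.

End LinearAlgebra.

(** * Integrals of continuous functions over segments *)

Section Integrals.
Variable R : realType.
Implicit Types (f g p : R -> R) (k : R).
Notation mu := (@lebesgue_measure R).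
Notation "'I[' a , b ] f" := (Rintegral mu `[a, b]%classic f)
  (at level 10, a, b at level 200, f at level 9).

Lemma cont_integrable (a b : R) (f : R -> R) : continuous f ->
  mu.-integrable `[a, b]%classic (EFin \o f).
Proof.
move=> cf; apply: continuous_compact_integrable; first exact: segment_compact.
exact: continuous_subspaceT.
Qed.

Lemma IntD (a b : R) f g : continuous f -> continuous g ->
  I[a, b] (fun x => f x + g x) = I[a, b] f + I[a, b] g.
Proof. by move=> cf cg; apply: RintegralD => //; exact: cont_integrable. Qed.

Lemma IntZ (a b : R) (k : R) f : continuous f ->
  I[a, b] (fun x => k * f x) = k * I[a, b] f.
Proof. by move=> cf; apply: RintegralZl => //; exact: cont_integrable. Qed.

Lemma Int_le (a b : R) f g : continuous f -> continuous g ->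
  (forall x, a <= x <= b -> f x <= g x) -> I[a, b] f <= I[a, b] g.
Proof.
move=> cf cg H; apply: le_Rintegral; [by []|exact: cont_integrable..|].
by move=> x /=; rewrite in_itv /=; exact: H.
Qed.

Lemma Int_ge0 (a b : R) f : (forall x, 0 <= f x) -> 0 <= I[a, b] f.
Proof. by move=> H; apply: Rintegral_ge0 => x _. Qed.

Lemma Int_cst (a b k : R) : a <= b -> I[a, b] (fun=> k) = k * (b - a).
Proof.
move=> ab; rewrite Rintegral_cst //; congr (_ * _).
rewrite -[X in fine X]/(lebesgue_measure [set` `[a, b]%R]) lebesgue_measure_itv /= lte_fin.
by case: ltgtP ab => //= -> _; rewrite subrr.
Qed.

Lemma Int_subset (a b c d : R) f : continuous f -> (forall x, 0 <= f x) ->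
  a <= c -> d <= b -> I[c, d] f <= I[a, b] f.
Proof.
move=> cf f0 ac db; apply: fine_le.
- exact: integrable_fin_num (cont_integrable _ _ cf).
- exact: integrable_fin_num (cont_integrable _ _ cf).
apply: ge0_subset_integral => //.
- by have /integrableP[] := cont_integrable a b cf.
- by move=> x _; rewrite lee_fin.
- by move=> x /=; rewrite !in_itv /= => /andP[cx xd]; rewrite (le_trans ac) // (le_trans xd).
Qed.

Lemma Int_FTC (a b : R) (F f : R -> R) : a <= b ->
  (forall x : R, is_derive x 1 F (f x)) -> continuous f ->
  I[a, b] f = F b - F a.
Proof.
rewrite le_eqVlt => /predU1P[-> _ _|ab DF cf].
  by rewrite set_itv1 Rintegral_set1 subrr.
have cF : continuous F by move=> x; exact: is_derive_continuous (DF x).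
rewrite /Rintegral (@continuous_FTC2 _ f F) //.
- exact: continuous_subspaceT.
- split; first by move=> x _; have [] := DF x.
  + exact: cvg_at_right_filter (cF a).
  + exact: cvg_at_left_filter (cF b).
- by move=> x _; rewrite derive1E; have [_ ->] := DF x.
Qed.

Lemma oscillation_le (a b x y : R) (F f p : R -> R) : a <= x <= b -> a <= y <= b ->
  (forall x : R, is_derive x 1 F (f x)) -> continuous f -> continuous p ->
  (forall x, `|f x| <= p x) -> `|F x - F y| <= I[a, b] p.
Proof.
wlog yx : x y / y <= x.
  move=> H hx hy; have [yx|/ltW xy] := leP y x; first exact: H.
  by rewrite distrC; exact: H.
move=> /andP[ax xb] /andP[ay yb] DF cf cp fp.
rewrite -(Int_FTC yx DF cf).
apply: le_trans (le_normr_Rintegral _ (cont_integrable _ _ cf)) _ => //.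
have cn : continuous (fun x => `|f x|).
  by move=> z; apply: cvg_norm; exact: cf.
apply: (@le_trans _ _ (I[y, x] p)); first by apply: Int_le.
by apply: Int_subset => // z; exact: le_trans (fp z).
Qed.

(** Nonnegativity of the integral of [(f - m)^2], where [m] is the mean of [f]. *)
Lemma Int_CauchySchwarz (a b : R) f : a < b -> continuous f ->
  (I[a, b] f) ^+ 2 <= (b - a) * I[a, b] (fun x => f x ^+ 2).
Proof.
move=> ab cf; have ba : 0 < b - a by rewrite subr_gt0.
pose m := I[a, b] f / (b - a).
have c2 : continuous (fun x => f x ^+ 2).
  by move=> x; exact: (cvgM (cf x) (cf x)).
have cm : continuous (fun x => - (2 * m) * f x).
  by move=> x; apply: cvgMl_tmp; exact: cf.
have cc : continuous (fun _ : R => m ^+ 2) by exact: cst_continuous.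
have cs : continuous (fun x => f x ^+ 2 + - (2 * m) * f x).
  by move=> x; apply: cvgD; [exact: c2|exact: cm].
have : 0 <= I[a, b] (fun x => (f x ^+ 2 + - (2 * m) * f x) + m ^+ 2).
  apply: Int_ge0 => x.
  by rewrite (_ : _ + _ = (f x - m) ^+ 2) ?sqr_ge0 //; ring.
rewrite IntD // IntD // IntZ // (Int_cst _ (ltW ab)).
have -> : I[a, b] f = m * (b - a) by rewrite /m divfK // gt_eqF.
move=> H; rewrite -subr_ge0; have := mulr_ge0 (ltW ba) H.
by congr (0 <= _); ring.
Qed.

Lemma rect_bounded (a b c d : R) (f : R * R -> R) : continuous f ->
  a <= b -> c <= d ->
  exists B, 0 <= B /\ forall x y, a <= x <= b -> c <= y <= d -> `|f (x, y)| <= B.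
Proof.
move=> cf ab cd.
have cA := compact_setX (@segment_compact R a b) (@segment_compact R c d).
have cn : continuous (fun q => `|f q|).
  by move=> z; apply: cvg_norm; exact: cf.
have [|q _ Hq] := compact_EVT_max _ cA (continuous_subspaceT cn).
  by exists (a, c); split; rewrite /= in_itv /= lexx.
exists `|f q|; split => // x y xab ycd; apply: (Hq (x, y)).
by rewrite inE; split; rewrite /= in_itv.
Qed.

Lemma continuous_slice (f : R -> R -> R) (t : R) :
  continuous (fun q : R * R => f q.1 q.2) -> continuous (f t).
Proof.
move=> cf x.
have H : {for x, continuous (fun y : R => (t, y))}.
  apply: (@cvg_pair _ _ _ (nbhs x) (nbhs t) (nbhs x) _ _ _ (fun=> t) id).
    exact: cvg_cst.
  exact: cvg_id.
exact: (continuous_comp H (cf (t, x))).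
Qed.

(** Differentiation under the integral sign; the dominating function is a constant, the bound of
    [ft] on the compact rectangle around [t]. *)
Lemma is_derive_Int (a b : R) (f ft : R -> R -> R) (t : R) : a <= b ->
  (forall t x : R, is_derive t 1 (fun s => f s x) (ft t x)) ->
  continuous (fun q : R * R => f q.1 q.2) ->
  continuous (fun q : R * R => ft q.1 q.2) ->
  is_derive t 1 (fun s => I[a, b] (f s)) (I[a, b] (ft t)).
Proof.
move=> ab Df cf cft.
have tt : t - 1 <= t + 1 by lra.
have [B [B0 HB]] := rect_bounded cft tt ab.
have It : `]t - 1, t + 1[%classic t by rewrite /= in_itv /=; lra.
have mB : measurable (`[a, b]%classic : set (measurableTypeR R)) by [].
have intf x : `]t - 1, t + 1[%classic x -> mu.-integrable `[a, b]%classic (EFin \o f x).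
  by move=> _; apply: cont_integrable; exact: continuous_slice.
have derf x y : `]t - 1, t + 1[%classic x -> `[a, b]%classic y -> derivable (f ^~ y) x 1.
  by move=> _ _; have [] := Df x y.
have intG : mu.-integrable `[a, b]%classic (EFin \o (fun=> B)).
  by apply: cont_integrable; exact: cst_continuous.
have Gub x y : `]t - 1, t + 1[%classic x -> `[a, b]%classic y ->
    `|partial1of2 f x y| <= B.
  rewrite /= !in_itv /= => /andP[x1 x2] yab.
  by rewrite partial1of2E; have [_ ->] := Df x y; apply: HB; rewrite // !ltW.
have H1 := derivable_under_integral mB It intf derf (fun=> B0) intG Gub.
have H2 := differentiation_under_integral mB It intf derf (fun=> B0) intG Gub.
apply: DeriveDef => //; rewrite -derive1E H2; apply: eq_Rintegral => x _.
by rewrite partial1of2E; have [_ ->] := Df t x.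
Qed.

End Integrals.

(** * Smooth functions of two variables *)

(* Both mixed partials are limits of the second difference over a square. *)
Lemma mixed_partials (R : realType) (f ft fs fts fst' : R -> R -> R) (t s : R) :
  (forall t s : R, is_derive t 1 (f ^~ s) (ft t s)) ->
  (forall t s : R, is_derive s 1 (f t) (fs t s)) ->
  (forall t s : R, is_derive s 1 (ft t) (fts t s)) ->
  (forall t s : R, is_derive t 1 (fs ^~ s) (fst' t s)) ->
  continuous (fun q : R * R => fts q.1 q.2) ->
  continuous (fun q : R * R => fst' q.1 q.2) ->
  fts t s = fst' t s.
Proof.
move=> Dt Ds Dts Dst c1 c2; apply/eqP; rewrite -subr_eq0 -normr_le0.
apply/ler_addgt0Pl => e e0; rewrite addr0.
have e2 : 0 < e / 2 by rewrite divr_gt0.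
have /cvgrPdist_le/(_ _ e2) n1 := c1 (t, s).
have /cvgrPdist_le/(_ _ e2) n2 := c2 (t, s).
have N : nbhs ((t, s) : R * R) [set q | `|fts t s - fts q.1 q.2| <= e / 2 /\
    `|fst' t s - fst' q.1 q.2| <= e / 2] by exact: filterI n1 n2.
have [r /= r0 Hr] := (nbhs_ballP _ _).1 N.
pose h := r / 2.
have h0 : 0 < h by rewrite divr_gt0.
have hr : `|h| < r by rewrite gtr0_norm // /h; lra.
have inb x y : `|x| <= `|h| -> `|y| <= `|h| -> ball (t, s) r (x + t, y + s).
  by move=> xh yh; split; rewrite /= -ball_normE /= opprD addrCA subrr addr0 normrN;
    apply: le_lt_trans hr.
have [x|x xh Ex] := @mean_value0 R (fun x => f (x + t) (h + s) - f (x + t) s)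
  (fun x => ft (x + t) (h + s) - ft (x + t) s) h.
  by move=> _; apply: is_deriveB; apply: (@is_derive_shift1 _ _ (fun z => f z _)).
have [y|y yh Ey] := @mean_value0 R (fun y => ft (x + t) (y + s))
  (fun y => fts (x + t) (y + s)) h.
  by move=> _; apply: is_derive_shift1.
have [y'|y' yh' Ey'] := @mean_value0 R (fun y => f (h + t) (y + s) - f t (y + s))
  (fun y => fs (h + t) (y + s) - fs t (y + s)) h.
  by move=> _; apply: is_deriveB; apply: is_derive_shift1.
have [x'|x' xh' Ex'] := @mean_value0 R (fun x => fs (x + t) (y' + s))
  (fun x => fst' (x + t) (y' + s)) h.
  by move=> _; apply: (@is_derive_shift1 _ _ (fun z => fs z _)).
rewrite !add0r in Ex Ey Ex' Ey'.
have E : fts (x + t) (y + s) = fst' (x' + t) (y' + s).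
  have : fts (x + t) (y + s) * h * h = fst' (x' + t) (y' + s) * h * h.
    by rewrite -Ey -Ex' -Ex -Ey'; ring.
  by move=> /(mulIf (lt0r_neq0 h0)) /(mulIf (lt0r_neq0 h0)).
have [H1 _] := Hr _ (inb _ _ xh yh).
have [_ H2] := Hr _ (inb _ _ xh' yh').
rewrite /= in H1 H2.
rewrite (_ : _ - _ = (fts t s - fts (x + t) (y + s)) - (fst' t s - fst' (x' + t) (y' + s))).
  by rewrite (splitr e) (le_trans (ler_normB _ _)) // lerD.
by rewrite E; ring.
Qed.

Section Smooth2.
Variables (R : realType) (K : nat).
Notation V := 'cV[R]_K.
Implicit Types u v w : R -> R -> V.

Lemma pder_rcons s b u :
  pder (rcons s b) u = pder s (if b then dt u else dth u).
Proof. by elim: s => [|c s IH] /=; [case: b | rewrite IH]. Qed.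

Lemma smooth2_dt u : smooth2 u -> smooth2 (dt u).
Proof. by move=> H s; rewrite -(pder_rcons s true); exact: H. Qed.

Lemma smooth2_dth u : smooth2 u -> smooth2 (dth u).
Proof. by move=> H s; rewrite -(pder_rcons s false); exact: H. Qed.

Lemma smooth2_derive_t u (t th : R) : smooth2 u ->
  is_derive t 1 (fun s => u s th) (dt u t th).
Proof.
move=> H; have [H1 _] := H [::]; have [D1 _] := H1 t th.
by apply: DeriveDef; [exact: D1|rewrite /dt derive1E].
Qed.

Lemma smooth2_derive_th u (t th : R) : smooth2 u ->
  is_derive th 1 (u t) (dth u t th).
Proof.
move=> H; have [H1 _] := H [::]; have [_ D1] := H1 t th.
by apply: DeriveDef; [exact: D1|rewrite /dth derive1E].
Qed.

Lemma smooth2_continuous u : smooth2 u -> continuous (fun q : R * R => u q.1 q.2).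
Proof. by move=> H; have [] := H [::]. Qed.

Lemma smooth2_coord_continuous u i j : smooth2 u ->
  continuous (fun q : R * R => u q.1 q.2 i j).
Proof.
move=> su q; apply: (@continuous_comp _ _ _ (fun q : R * R => u q.1 q.2)
  (fun M : V => M i j) q); first exact: smooth2_continuous.
exact: coord_continuous.
Qed.

Lemma dt_eq u u' : (forall t th : R, is_derive t 1 (fun s => u s th) (u' t th)) ->
  dt u = u'.
Proof.
by move=> H; apply/funext => t; apply/funext => th; rewrite /dt derive1E; have [] := H t th.
Qed.

Lemma dth_eq u u' : (forall t th : R, is_derive th 1 (u t) (u' t th)) ->
  dth u = u'.
Proof.
by move=> H; apply/funext => t; apply/funext => th; rewrite /dth derive1E; have [] := H t th.
Qed.

Lemma dt_add u v : smooth2 u -> smooth2 v ->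
  dt (fun t th => u t th + v t th) = (fun t th => dt u t th + dt v t th).
Proof.
move=> su sv; apply: dt_eq => t th.
exact: (is_deriveD (smooth2_derive_t t th su) (smooth2_derive_t t th sv)).
Qed.

Lemma dth_add u v : smooth2 u -> smooth2 v ->
  dth (fun t th => u t th + v t th) = (fun t th => dth u t th + dth v t th).
Proof.
move=> su sv; apply: dth_eq => t th.
exact: (is_deriveD (smooth2_derive_th t th su) (smooth2_derive_th t th sv)).
Qed.

Lemma dt_mulmx (A : 'M[R]_K) u : smooth2 u ->
  dt (fun t th => A *m u t th) = (fun t th => A *m dt u t th).
Proof.
move=> su; apply: dt_eq => t th.
exact: (is_derive_mulmxl _ (smooth2_derive_t t th su)).
Qed.

Lemma dth_mulmx (A : 'M[R]_K) u : smooth2 u ->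
  dth (fun t th => A *m u t th) = (fun t th => A *m dth u t th).
Proof.
move=> su; apply: dth_eq => t th.
exact: (is_derive_mulmxl _ (smooth2_derive_th t th su)).
Qed.

Lemma smooth2_pder s u : smooth2 u -> smooth2 (pder s u).
Proof.
elim: s u => [|b s IH] u su; first exact: su.
by case: b; [exact: (smooth2_dt (IH _ su))|exact: (smooth2_dth (IH _ su))].
Qed.

Lemma smooth2_add u v : smooth2 u -> smooth2 v ->
  smooth2 (fun t th => u t th + v t th).
Proof.
move=> su sv.
have E s : pder s (fun t th => u t th + v t th) =
    (fun t th => pder s u t th + pder s v t th).
  by elim: s => //= -[] s ->; [apply: dt_add|apply: dth_add]; exact: smooth2_pder.
move=> s; rewrite E; have [su1 su2] := su s; have [sv1 sv2] := sv s; split.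
  move=> t th; have [a b] := su1 t th; have [c d] := sv1 t th.
  by split; [exact: (derivableD a c)|exact: (derivableD b d)].
by move=> q; exact: (cvgD (su2 q) (sv2 q)).
Qed.

Lemma smooth2_mulmx (A : 'M[R]_K) u : smooth2 u ->
  smooth2 (fun t th => A *m u t th).
Proof.
move=> su.
have E s : pder s (fun t th => A *m u t th) = (fun t th => A *m pder s u t th).
  by elim: s => //= -[] s ->; [apply: dt_mulmx|apply: dth_mulmx]; exact: smooth2_pder.
move=> s; rewrite E; have sp := smooth2_pder s su; split.
  move=> t th; split.
    by have [] := is_derive_mulmxl A (smooth2_derive_t t th sp).
  by have [] := is_derive_mulmxl A (smooth2_derive_th t th sp).
move=> q; apply: (@cvg_mx _ _ (nbhs q)) => i j.
rewrite mxE; under eq_fun do rewrite mxE.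
apply: cvg_sum_fin => k; apply: cvgMl_tmp.
exact: (smooth2_coord_continuous sp).
Qed.

Lemma continuous_dotv u v : smooth2 u -> smooth2 v ->
  continuous (fun q : R * R => dotv (u q.1 q.2) (v q.1 q.2)).
Proof.
move=> su sv q; rewrite /continuous_at /dotv mxE; under eq_fun do rewrite mxE.
apply: cvg_sum_fin => k; rewrite mxE; under eq_fun do rewrite mxE.
apply: cvgM.
  exact: (smooth2_coord_continuous su).
exact: (smooth2_coord_continuous sv).
Qed.

Lemma dt_dth u : smooth2 u -> dt (dth u) = dth (dt u).
Proof.
move=> su; apply/funext => t; apply/funext => th; apply/matrixP => i j.
have st := smooth2_dt su; have sh := smooth2_dth su.
apply/esym/(@mixed_partials R (fun t s => u t s i j) (fun t s => dt u t s i j)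
  (fun t s => dth u t s i j) (fun t s => dth (dt u) t s i j)
  (fun t s => dt (dth u) t s i j)).
- by move=> a b; have /is_derive_mxP := smooth2_derive_t a b su; apply.
- by move=> a b; have /is_derive_mxP := smooth2_derive_th a b su; apply.
- by move=> a b; have /is_derive_mxP := smooth2_derive_th a b st; apply.
- by move=> a b; have /is_derive_mxP := smooth2_derive_t a b sh; apply.
- by apply: smooth2_coord_continuous; exact: smooth2_dth.
- by apply: smooth2_coord_continuous; exact: smooth2_dt.
Qed.

Section Twisted.
Variable alpha : 'M[R]_K.
Notation D := (dtha alpha).

Lemma smooth2_dtha u : smooth2 u -> smooth2 (D u).
Proof.
by move=> su; apply: smooth2_add; [exact: smooth2_dth|exact: smooth2_mulmx].
Qed.

Lemma dt_dtha u : smooth2 u -> dt (D u) = D (dt u).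
Proof.
move=> su; rewrite -[D u]/(fun t th => dth u t th + alpha *m u t th).
rewrite dt_add; [|exact: smooth2_dth|exact: smooth2_mulmx].
rewrite (dt_mulmx _ su) (dt_dth su); reflexivity.
Qed.

Lemma on_cylinder_dt u : on_cylinder u -> on_cylinder (dt u).
Proof. by move=> cu t th; rewrite /dt; under eq_fun do rewrite cu. Qed.

Lemma on_cylinder_dtha u : smooth2 u -> on_cylinder u -> on_cylinder (D u).
Proof.
move=> su cu t th; rewrite /dtha cu.
have D1 := is_derive_shift1 (smooth2_derive_th t (th + 2 * pi) su).
have E : (fun s => u t (s + 2 * pi)) = u t by apply/funext => s; exact: cu.
rewrite E in D1; have [_ D2] := D1.
have [_ D3] := smooth2_derive_th t th su.
by rewrite -[X in X + _]D2 D3.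
Qed.

Hypothesis skew : alpha^T = - alpha.

(** The two [alpha] terms cancel by skew-symmetry: the connection is compatible with the inner
    product. *)
Lemma is_derive_dotv_dtha u v (t th : R) : smooth2 u -> smooth2 v ->
  is_derive th 1 (fun s => dotv (u t s) (v t s))
    (dotv (D u t th) (v t th) + dotv (u t th) (D v t th)).
Proof.
move=> su sv.
have H := is_derive_dotv (smooth2_derive_th t th su) (smooth2_derive_th t th sv).
have S a b : dotv (alpha *m a) b = - dotv a (alpha *m b).
  by rewrite /dotv trmx_mul skew mulmxN mulNmx -mulmxA [LHS]mxE.
apply: (is_derive_eq H); rewrite /dtha dotvDr (dotvC (_ + _)) dotvDr.
by rewrite !(dotvC (v t th)) S; ring.
Qed.

End Twisted.
End Smooth2.

(** * A gap for differential inequalities on the line *)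

Section Gap.
Variable R : realType.
Implicit Types (F B a G : R -> R).
Notation mu := (@lebesgue_measure R).

Lemma mvt_from0 G G1 (b : R) : (forall x : R, is_derive x 1 G (G1 x)) -> 0 <= b ->
  exists2 c, 0 <= c <= b & G b = G 0 + G1 c * b.
Proof.
move=> DG b0.
have cG : {within `[0, b], continuous G}.
  by apply: derivable_within_continuous => x _; have [] := DG x.
have [c] := MVT_segment b0 (fun x _ => DG x) cG.
by rewrite in_itv /= subr0 => cb E; exists c => //; rewrite -E addrC subrK.
Qed.

(** [G1 x >= - k x] on the interval, so [G x + k x^2 / 2] is nondecreasing there. *)
Lemma taylor2_lower G G1 F2 (k r s : R) :
  (forall x : R, is_derive x 1 G (G1 x)) -> (forall x : R, is_derive x 1 G1 (F2 x)) ->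
  (forall x, 0 <= x <= r -> - k <= F2 x) -> 0 <= G1 0 -> 0 <= s <= r ->
  G 0 - k * s ^+ 2 / 2 <= G s.
Proof.
move=> DG DG1 H G10 /andP[s0 sr].
have G1k x : 0 <= x <= r -> - k * x <= G1 x.
  move=> /andP[x0 xr]; have [c /andP[c0 cx] ->] := mvt_from0 DG1 x0.
  have : - k * x <= F2 c * x.
    by apply: ler_wpM2r => //; apply: H; rewrite c0 (le_trans cx).
  by lra.
have Dp (x : R) : is_derive x 1 (fun x => G x + k / 2 * x ^+ 2) (G1 x + k * x).
  have D2 : is_derive x 1 (fun x : R => k / 2 * x ^+ 2) (k * x).
    have D0 : is_derive x 1 (fun x : R => k / 2 * x ^+ 2) _ :=
      is_deriveZ (k / 2) (is_deriveX 2 (is_derive_id x (1 : R))).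
    apply: (is_derive_eq D0).
    by rewrite /GRing.scale /= expr1; field.
  exact: (is_deriveD (DG x) D2).
have [c /andP[c0 cs]] := mvt_from0 Dp s0.
have : 0 <= (G1 c + k * c) * s.
  apply: mulr_ge0 => //; have := G1k c; rewrite c0 (le_trans cs) //= => /(_ isT); lra.
by rewrite expr0n /= mulr0 addr0; lra.
Qed.

(** Used with [sg] equal to 1 or -1, to treat both directions of the line at once. *)
Lemma is_derive_reflect F F1 (t sg x : R) : (forall x : R, is_derive x 1 F (F1 x)) ->
  is_derive x 1 (fun s => F (t + s * sg)) (sg * F1 (t + x * sg)).
Proof.
move=> DF; have D1 : is_derive x 1 (fun s : R => t + s *: (sg : R^o)) sg.
  exact: (@is_derive_affine R R^o).
have := @is_derive1_comp _ F (fun s => t + s * sg) x _ _ (DF _) D1.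
by move=> D2; apply: (is_derive_eq D2); rewrite mulrC.
Qed.

(** Were the slope at 0 positive, the convex [G] would lie above its tangent and exceed [M] at
    [(M + 1) / G1 0]. *)
Lemma convex_bounded_slope G G1 F2 (M : R) :
  (forall x : R, is_derive x 1 G (G1 x)) -> (forall x : R, is_derive x 1 G1 (F2 x)) ->
  (forall x, 0 <= F2 x) -> (forall x, 0 <= G x <= M) -> G1 0 <= 0.
Proof.
move=> DG DG1 F20 GM; rewrite leNgt; apply/negP => p.
have M0 : 0 <= M by have /andP[] := GM 0; exact: le_trans.
have s0 : 0 <= (M + 1) / G1 0 by rewrite divr_ge0 ?addr_ge0 // ltW.
have [c /andP[c0 cs] E] := mvt_from0 DG s0.
have [c' _ E'] := mvt_from0 DG1 c0.
have : G1 0 * ((M + 1) / G1 0) <= G1 c * ((M + 1) / G1 0).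
  by apply: ler_wpM2r => //; rewrite E' lerDl mulr_ge0.
rewrite mulrC divfK ?gt_eqF //.
have /andP[_] := GM ((M + 1) / G1 0); have /andP[] := GM 0; rewrite E; lra.
Qed.

(* Heinz's trick: maximise [(1 - |t - t0|) F t]. At the maximum [t1], with value
   [m = F t1], [F <= 2 m] nearby, so [F'' >= - k m^3] and [F >= m / 2] on an
   interval of length comparable to [1 / m], whose energy is bounded below. *)
Lemma heinz (F F1 F2 : R -> R) (delta k kap t0 : R) :
  0 < delta -> 0 <= k -> 0 < kap -> kap <= delta / 2 -> kap <= 1 -> k * kap <= 1 ->
  (forall x : R, is_derive x 1 F (F1 x)) -> (forall x : R, is_derive x 1 F1 (F2 x)) ->
  (forall x, 0 <= F x) ->
  (forall t m, delta <= m -> F t <= 2 * m -> - (k * m ^+ 3) <= F2 t) ->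
  delta < F t0 ->
  exists p q m, [/\ t0 - 1 <= p, q <= t0 + 1, p <= q, m * (q - p) = kap &
    forall x, p <= x <= q -> m / 2 <= F x].
Proof.
move=> delta0 k0 kap0 kapd kap1 kk DF DF1 F0 HF2 Ft0.
have cF : continuous F by move=> x; exact: is_derive_continuous (DF x).
pose g t := (1 - `|t - t0|) * F t.
have cg : continuous g.
  move=> x; apply: cvgM; last exact: cF.
  apply: cvgB; first exact: cvg_cst.
  by apply: cvg_norm; apply: cvgB; [exact: cvg_id|exact: cvg_cst].
have [t1] := @EVT_max R g (t0 - 1) (t0 + 1) ltac:(lra) (continuous_subspaceT cg).
rewrite in_itv /= => t1b gmax.
set d := 1 - `|t1 - t0|; set m := F t1.
have gt0 : delta < d * m.
  have := gmax t0; rewrite in_itv /= /g subrr normr0 subr0 mul1r => H.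
  by apply: lt_le_trans Ft0 _; apply: H; lra.
have m0 : 0 <= m by exact: F0.
have d1 : d <= 1 by rewrite /d; have := normr_ge0 (t1 - t0); lra.
have dp : 0 < d by rewrite ltNge; apply/negP => d0; nra.
have mp : 0 < m by nra.
have md : delta <= m by nra.
have near1 t : `|t - t1| <= d / 2 -> F t <= 2 * m.
  move=> tt; have h : `|t - t0| <= `|t - t1| + `|t1 - t0|.
    by have := ler_distD t1 t t0.
  have hd : d / 2 <= 1 - `|t - t0| by move: tt h; rewrite /d; lra.
  have tb : t0 - 1 <= t <= t0 + 1.
    have : `|t - t0| <= 1 by move: hd dp; lra.
    by rewrite ler_norml; lra.
  have := gmax t; rewrite in_itv /= => /(_ tb); rewrite /g -/d -/m => H.
  by have := F0 t; nra.
pose r := kap / m.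
have r0 : 0 <= r by rewrite divr_ge0 // ltW.
have rm : m * r = kap by rewrite /r mulrC divfK // gt_eqF.
(* From [kap <= delta / 2] and [delta < d * m]; within distance [d / 2] of [t1] the weight is still
   at least [d / 2]. *)
have rd : r <= d / 2.
  rewrite /r ler_pdivrMr //; nra.
(* The weight shifts the maximum, so [t1] need not be critical for [F]. One moves in the direction
   in which [F] has nonnegative slope, where Taylor's lower bound has no linear loss. *)
pose sg : R := if 0 <= F1 t1 then 1 else -1.
have sg2 : sg * sg = 1 by rewrite /sg; case: ifP => _; ring.
have sgn : `|sg| = 1 by rewrite /sg; case: ifP; rewrite ?normrN normr1.
have low s : 0 <= s <= r -> m / 2 <= F (t1 + s * sg).
  move=> sr.
  have D1 (x : R) := @is_derive_reflect F F1 t1 sg x DF.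
  have D2 (x : R) : is_derive x 1 (fun s => sg * F1 (t1 + s * sg)) (F2 (t1 + x * sg)).
    have D3 : is_derive x 1 (fun s => sg * F1 (t1 + s * sg)) _ :=
      is_deriveZ sg (@is_derive_reflect F1 F2 t1 sg x DF1).
    by apply: (is_derive_eq D3); rewrite /GRing.scale /= mulrA sg2 mul1r.
  have := @taylor2_lower _ _ _ (k * m ^+ 3) r s D1 D2 _ _ sr.
  rewrite mul0r addr0 -/m => H; apply: le_trans (H _ _).
  (* Since [m s <= kap], the quadratic loss [k m^3 s^2 / 2] is [m / 2] times a factor at most
     [k kap^2 <= 1]. *)
  - have s1 : (m * s) ^+ 2 <= kap ^+ 2.
      have /andP[s0 s1] := sr.
      by rewrite lerXn2r ?nnegrE ?mulr_ge0 ?(ltW kap0) // -rm ler_wpM2l.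
    have s2 : k * (m * s) ^+ 2 <= 1.
      apply: (@le_trans _ _ (k * kap ^+ 2)); first by apply: ler_wpM2l.
      by rewrite expr2 mulrA; apply: mulr_ile1 => //; rewrite ?mulr_ge0 // ltW.
    have -> : k * m ^+ 3 * s ^+ 2 / 2 = m / 2 * (k * (m * s) ^+ 2) by field.
    have : m / 2 * (k * (m * s) ^+ 2) <= m / 2 * 1 by apply: ler_wpM2l => //; lra.
    by lra.
  - move=> x /andP[x0 xr]; apply: HF2 => //; apply: near1.
    by rewrite addrC addKr normrM sgn mulr1 ger0_norm // (le_trans xr).
  - rewrite /sg; case: ifP => [h|/negbT]; first by rewrite mul1r.
    by rewrite -ltNge => h; rewrite mulN1r oppr_ge0 ltW.
have t1d : t0 - 1 <= t1 - d /\ t1 + d <= t0 + 1.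
  by move: (ler_norm (t1 - t0)) (ler_norm (- (t1 - t0))); rewrite normrN /d; lra.
have [F1p|F1n] := boolP (0 <= F1 t1).
  exists t1, (t1 + r), m; split; [by lra|by lra|by lra|by rewrite addrC addKr|].
  move=> x xr; have := low (x - t1); rewrite /sg F1p.
  by rewrite (_ : t1 + (x - t1) * 1 = x) => [|]; [apply; lra|ring].
exists (t1 - r), t1, m; split; [by lra|by lra|by lra|by rewrite opprB addrC subrK|].
move=> x xr; have := low (t1 - x); rewrite /sg (negbTE F1n).
by rewrite (_ : t1 + (t1 - x) * -1 = x) => [|]; [apply; lra|ring].
Qed.

(** [T] is the length of the circle, [c] the Poincare constant, [D] the curvature factor and [H] the
    Hopf constant. [eps] precedes the functions because it must not depend on the map. *)
Lemma gap_constant (T c D : R) : 0 < T -> 0 <= c -> 0 < D ->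
  exists eps, 0 < eps /\ forall F F1 F2 B a (H : R),
   (forall x : R, is_derive x 1 F (F1 x)) -> (forall x : R, is_derive x 1 F1 (F2 x)) ->
   (forall t, 0 <= F t) -> (forall t, 0 <= B t) ->
   (forall t, a t = H + 2 * F t) -> (forall t, F t <= a t) -> (forall t, `|H| <= a t) ->
   (forall t, Rintegral mu `[t - 1, t + 1]%classic a <= eps ^+ 2) ->
   (forall t, 2 * B t - 2 * D * c * B t * a t <= F2 t) ->
   (forall t l, 0 < l ->
      2 * B t - 2 * D * ((T^-1 + l) * F t + B t / l) * a t <= F2 t) ->
   forall t, B t = 0.
Proof.
move=> T0 c0 D0.
have Dc : 0 <= D * c by rewrite mulr_ge0 // ltW.
(* Makes [D c a <= 1 / 2] as soon as [a <= 3 delta], that is, when [H] and [F] are both at most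
   [delta]. *)
pose delta := (6 * (D * c + 1))^-1.
have delta0 : 0 < delta by rewrite invr_gt0; lra.
(* 20 is the product of 2 from the inequality for [F2], 2 from [F <= 2 m] and 5 from [a <= 5 m]. *)
pose k := 20 * D * (T^-1 / delta + 5 * D).
have k0 : 0 <= k.
  have h1 : 0 <= T^-1 / delta by apply: divr_ge0; [rewrite invr_ge0|]; exact: ltW.
  by rewrite /k; apply: mulr_ge0; lra.
pose kap := Num.min (delta / 2) (k + 1)^-1.
have kap0 : 0 < kap by rewrite lt_min invr_gt0 divr_gt0 //=; lra.
have kapd : kap <= delta / 2 by rewrite ge_min lexx.
have kapk : kap <= (k + 1)^-1 by rewrite ge_min lexx orbT.
have kk : k * kap <= 1.
  apply: (@le_trans _ _ (k * (k + 1)^-1)); first exact: ler_wpM2l.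
  by rewrite ler_pdivrMr; lra.
have kap1 : kap <= 1 by apply: le_trans kapk _; rewrite invf_le1; lra.
pose eps := Num.min 1 (Num.min (kap / 4) delta).
have eps0 : 0 < eps by rewrite !lt_min ltr01 delta0 divr_gt0.
have eps1 : eps <= 1 by rewrite ge_min lexx.
have epsk : eps <= kap / 4 by rewrite !ge_min lexx orbT.
have epsd : eps <= delta by rewrite !ge_min lexx !orbT.
have epse : eps ^+ 2 <= eps by rewrite expr2 ler_piMl // ltW.
exists eps; split => // F F1 F2 B a H DF DF1 F0 B0 aE Fa Ha Ia I1 I2.
have cF : continuous F by move=> x; exact: is_derive_continuous (DF x).
have ca : continuous a.
  rewrite (_ : a = fun t => H + 2 * F t); last by apply/funext.
  by move=> x; apply: cvgD; [exact: cvg_cst|apply: cvgMl_tmp; exact: cF].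
have a0 t : 0 <= a t by exact: le_trans (F0 t) (Fa t).
have H2 : `|H| <= delta.
  have cH : continuous (fun _ : R => `|H|) by exact: cst_continuous.
  have := Int_le cH ca (a := -1) (b := 1) (fun x _ => Ha x).
  have := Ia 0; rewrite sub0r add0r => h1 h2; have := le_trans h2 h1.
  by rewrite Int_cst ?lerN1 //; lra.
have Hle := ler_norm H.
have Fle t0 : F t0 <= delta.
  rewrite leNgt; apply/negP => Ft0.
  have [|p [q [m [pt qt pq mk low]]]] :=
    @heinz F F1 F2 delta k kap t0 delta0 k0 kap0 kapd kap1 kk DF DF1 F0 _ Ft0.
    move=> t m dm Fm; have mp : 0 < m by exact: lt_le_trans delta0 dm.
    have am : a t <= 5 * m by rewrite aE; lra.
    (* With [l = 5 D m] and [a <= 5 m] the [B / l] term costs at most [2 B], exactly what is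
       available. *)
    have l0 : 0 < 5 * D * m by rewrite !mulr_gt0.
    apply: le_trans (I2 t _ l0).
    set X := B t / (5 * D * m).
    have X0 : 0 <= X by rewrite divr_ge0 // ltW.
    have XB : X * (5 * D * m) = B t by rewrite /X divfK // gt_eqF.
    have Y1 : D * X * a t <= B t.
      by rewrite -XB (_ : X * _ = D * X * (5 * m)); [apply: ler_wpM2l => //; rewrite mulr_ge0 // ltW|ring].
    have Tm : T^-1 <= T^-1 / delta * m.
      by rewrite -mulrA ler_peMr ?invr_ge0 ?(ltW T0) // mulrC ler_pdivlMr // mul1r.
    have Ti : 0 <= T^-1 by rewrite invr_ge0 ltW.
    have Y2 : (T^-1 + 5 * D * m) * F t * a t <=
        ((T^-1 / delta + 5 * D) * m) * (2 * m) * (5 * m).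
      apply: ler_pM => //; first by rewrite mulr_ge0 // addr_ge0 // ltW.
      apply: ler_pM => //; first by rewrite addr_ge0 // ltW.
      by rewrite mulrDl; lra.
    have Y3 := ler_wpM2l (ltW D0) Y2.
    have -> : k * m ^+ 3 = 2 * (D * ((T^-1 / delta + 5 * D) * m * (2 * m) * (5 * m))).
      by rewrite /k; ring.
    have -> : 2 * D * ((T^-1 + 5 * D * m) * F t + X) * a t =
       2 * (D * ((T^-1 + 5 * D * m) * F t * a t)) + 2 * (D * X * a t) by ring.
    by lra.
  have L1 : kap / 2 <= Rintegral mu `[p, q]%classic a.
    rewrite -mk (_ : m * (q - p) / 2 = m / 2 * (q - p)); last by ring.
    rewrite -(Int_cst _ pq); apply: Int_le => //; first exact: cst_continuous.
    by move=> x xpq; exact: le_trans (low x xpq) (Fa x).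
  have L2 := Int_subset ca a0 pt qt.
  by have := Ia t0; lra.
have F2B t : B t <= F2 t.
  apply: le_trans (I1 t).
  have at3 : a t <= 3 * delta by rewrite aE; have := Fle t; lra.
  have h : D * c * a t <= 1 / 2.
    apply: (@le_trans _ _ (D * c * (3 * delta))); first exact: ler_wpM2l.
    have -> : D * c * (3 * delta) = 2^-1 * (D * c / (D * c + 1)).
      by rewrite /delta; field; rewrite gt_eqF //; lra.
    by rewrite mul1r ler_piMr // ler_pdivrMr; lra.
  have := ler_wpM2l (B0 t) h.
  rewrite (_ : 2 * D * c * B t * a t = 2 * (B t * (D * c * a t))); last by ring.
  by lra.
have F20 t : 0 <= F2 t by exact: le_trans (B0 t) (F2B t).
have slope sg t : sg * sg = 1 -> sg * F1 t <= 0.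
  move=> sg2.
  have D1 (x : R) := @is_derive_reflect F F1 t sg x DF.
  have D2 (x : R) : is_derive x 1 (fun s => sg * F1 (t + s * sg)) (F2 (t + x * sg)).
    have D3 : is_derive x 1 (fun s => sg * F1 (t + s * sg)) _ :=
      is_deriveZ sg (@is_derive_reflect F1 F2 t sg x DF1).
    by apply: (is_derive_eq D3); rewrite /GRing.scale /= mulrA sg2 mul1r.
  have := @convex_bounded_slope _ _ _ delta D1 D2 (fun=> F20 _).
  by rewrite mul0r addr0; apply => x; rewrite F0 Fle.
have F10 : F1 = cst 0.
  apply/funext => t; apply/le_anti/andP; split.
    by have := slope 1 t; rewrite !mul1r; apply.
  by have := slope (-1) t; rewrite !mulN1r oppr_le0 opprK; apply.
move=> t; apply/le_anti; rewrite B0 andbT; apply: le_trans (F2B t) _.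
have [_ <-] := DF1 t; rewrite F10.
by have [_ ->] := is_derive_cst (0 : R) t (1 : R).
Qed.

End Gap.

(** * Young's inequality, untwisting and periodicity *)

Section Young.
Variables (R : realType) (K : nat).
Implicit Types v w : 'cV[R]_K.

(** Expansion of [|l v + w|^2 >= 0] and [|l v - w|^2 >= 0]. The symmetric left-hand side is the form
    in which the derivative of [|v|^2] arises. *)
Lemma young_dotv v w (l : R) : 0 < l ->
  `|dotv w v + dotv v w| <= l * sqnorm v + l^-1 * sqnorm w.
Proof.
move=> l0.
have E k : sqnorm (l *: v + k *: w) =
    l * (l * sqnorm v + k * (dotv w v + dotv v w) + k ^+ 2 * (l^-1 * sqnorm w)).
  rewrite /sqnorm dotvDr !(dotvC (_ + _)) !dotvDr !dotvZr.
  rewrite !(dotvC (_ *: _)) !dotvZr (dotvC w v); field.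
  by rewrite gt_eqF.
have P k : 0 <= l * sqnorm v + k * (dotv w v + dotv v w) + k ^+ 2 * (l^-1 * sqnorm w).
  by have := sqnorm_ge0 (l *: v + k *: w); rewrite E pmulr_rge0.
have := P 1; have := P (-1); rewrite sqrrN expr1n !mul1r !mulN1r ler_norml; lra.
Qed.

End Young.

Section Untwisting.
Variables (R : realType) (K : nat) (alpha : 'M[R]_K).
Notation V := 'cV[R]_K.
Notation D := (dtha alpha).
Notation E s := (expm (s *: alpha)).

(** Differentiate [E^T E = 1] at 0. *)
Lemma orth_expm_skew : (forall s, (E s)^T *m E s = 1%:M) -> alpha^T = - alpha.
Proof.
move=> orth.
have D1 := is_derive_expm alpha 0.
have D2 : is_derive (0 : R) 1 (fun s => (E s)^T) (alpha *m E 0)^T.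
  apply/is_derive_mxP => i j; rewrite mxE; under eq_fun do rewrite mxE.
  by move/is_derive_mxP : D1; apply.
have [_ D3] := is_derive_mulmx D2 D1.
have E1 : (fun s => (E s)^T *m E s) = cst 1%:M by apply/funext => s; exact: orth.
rewrite E1 expm0 !mulmx1 trmx1 mul1mx derive_cst in D3.
by apply/eqP; rewrite -addr_eq0 -D3.
Qed.

(** A change of gauge: multiplication by [exp (s alpha)] turns [D] into the plain derivative, at the
    price of replacing periodicity by the holonomy. *)
Lemma is_derive_untwist (w : R -> R -> V) (t th s : R) : smooth2 w ->
  is_derive s 1 (fun s => E s *m w t (s + th)) (E s *m D w t (s + th)).
Proof.
move=> sw.
have H := is_derive_mulmx (is_derive_expm alpha s)
  (is_derive_shift1 (smooth2_derive_th t (s + th) sw)).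
apply: (is_derive_eq H); rewrite /dtha mulmxDr addrC; congr (_ + _).
by rewrite expm_comm mulmxA.
Qed.

End Untwisting.

Section Periodic.
Variable R : realType.

Lemma periodic_reduce (T : Type) (f : R -> T) (p : R) : 0 < p ->
  (forall x, f (x + p) = f x) -> forall x, exists2 y, 0 <= y <= p & f x = f y.
Proof.
move=> p0 fp x.
have fn (n : nat) y : f (y + n%:R * p) = f y.
  elim: n y => [|n IH] y; first by rewrite mul0r addr0.
  by rewrite -natr1 mulrDl mul1r addrA fp IH.
have fz (m : int) y : f (y + m%:~R * p) = f y.
  case: m => n; first exact: fn.
  by rewrite NegzE mulrNz mulNr -[in RHS](subrK (n.+1%:R * p) y) fn.
exists (x - (Num.floor (x / p))%:~R * p); last by rewrite -[RHS](fz (Num.floor (x / p))) subrK.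
have /andP[h1 h2] := floor_itv (x / p).
have h3 : (Num.floor (x / p))%:~R * p <= x by rewrite -ler_pdivlMr.
have h4 : x < (Num.floor (x / p))%:~R * p + p.
  by rewrite -[X in _ + X]mul1r -mulrDl -ltr_pdivrMr // -intrD1.
by lra.
Qed.

End Periodic.

(** * Integrals over circles and the twisted Poincare inequality *)

Section Slices.
Variables (R : realType) (K : nat) (alpha : 'M[R]_K).
Notation V := 'cV[R]_K.
Notation D := (dtha alpha).
Notation E s := (expm (s *: alpha)).
Notation mu := (@lebesgue_measure R).
Notation T := (2 * pi : R).
Implicit Types u v w : R -> R -> V.

Let T0 : 0 < T. Proof. by rewrite mulr_gt0 // pi_gt0. Qed.

Definition slice_dot v w (t : R) : R :=
  Rintegral mu `[0, T]%classic (fun th => dotv (v t th) (w t th)).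

Lemma continuous_slice_dotv v w t : smooth2 v -> smooth2 w ->
  continuous (fun th => dotv (v t th) (w t th)).
Proof.
move=> sv sw; exact: (@continuous_slice _ (fun t th => dotv (v t th) (w t th)) t
  (continuous_dotv sv sw)).
Qed.

Lemma slice_dot_ge0 v t : 0 <= slice_dot v v t.
Proof. by apply: Int_ge0 => x; exact: sqnorm_ge0. Qed.

Lemma slice_dotC v w t : slice_dot v w t = slice_dot w v t.
Proof. by rewrite /slice_dot; congr Rintegral; apply/funext => th; rewrite dotvC. Qed.

Lemma slice_dotBr u v w t : smooth2 u -> smooth2 v -> smooth2 w ->
  slice_dot u (fun t th => v t th - w t th) t = slice_dot u v t - slice_dot u w t.
Proof.
move=> su sv sw; rewrite /slice_dot -[X in _ = _ - X]mul1r -mulNr.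
rewrite -IntZ; last exact: continuous_slice_dotv.
rewrite -IntD; first by congr Rintegral; apply/funext => th; rewrite dotvBr mulN1r.
  exact: continuous_slice_dotv.
by move=> x; apply: cvgMl_tmp; exact: continuous_slice_dotv.
Qed.

Lemma is_derive_slice_dot v w (t : R) : smooth2 v -> smooth2 w ->
  is_derive t 1 (slice_dot v w) (slice_dot (dt v) w t + slice_dot v (dt w) t).
Proof.
move=> sv sw; have st := smooth2_dt sv; have sw' := smooth2_dt sw.
rewrite /slice_dot -IntD; try exact: continuous_slice_dotv.
apply: (@is_derive_Int _ 0 T (fun t th => dotv (v t th) (w t th))
  (fun t th => dotv (dt v t th) (w t th) + dotv (v t th) (dt w t th))).
- exact: ltW.
- move=> s x; exact: (is_derive_dotv (smooth2_derive_t s x sv) (smooth2_derive_t s x sw)).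
- exact: continuous_dotv.
- by move=> q; apply: cvgD; exact: continuous_dotv.
Qed.

Hypothesis skew : alpha^T = - alpha.

Lemma slice_dot_parts v w t : smooth2 v -> smooth2 w ->
  on_cylinder v -> on_cylinder w ->
  slice_dot (D v) w t = - slice_dot v (D w) t.
Proof.
move=> sv sw cv cw; have sDv := smooth2_dtha alpha sv; have sDw := smooth2_dtha alpha sw.
apply/eqP; rewrite -addr_eq0; apply/eqP.
rewrite /slice_dot -IntD; try exact: continuous_slice_dotv.
have cf : continuous (fun x => dotv (D v t x) (w t x) + dotv (v t x) (D w t x)).
  by move=> x; apply: cvgD; exact: continuous_slice_dotv.
rewrite (Int_FTC (ltW T0) (fun x => is_derive_dotv_dtha skew t x sv sw) cf).
by have := cv t 0; have := cw t 0; rewrite add0r => -> ->; rewrite subrr.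
Qed.

(** [|W|^2] exceeds its mean over the circle by at most the integral of [|2 <D W, W>|], which
    Young's inequality splits with weight [l]. *)
Lemma sup_le_mean w t th (l : R) : smooth2 w -> 0 <= th <= T -> 0 < l ->
  sqnorm (w t th) <= (T^-1 + l) * slice_dot w w t + slice_dot (D w) (D w) t / l.
Proof.
move=> sw thT l0; have sD := smooth2_dtha alpha sw.
pose p x := l * sqnorm (w t x) + l^-1 * sqnorm (D w t x).
have cq : continuous (fun x => sqnorm (w t x)) by exact: continuous_slice_dotv.
have cr : continuous (fun x => sqnorm (D w t x)) by exact: continuous_slice_dotv.
have clq : continuous (fun x => l * sqnorm (w t x)).
  by move=> x; apply: cvgMl_tmp; exact: cq.
have clr : continuous (fun x => l^-1 * sqnorm (D w t x)).
  by move=> x; apply: cvgMl_tmp; exact: cr.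
have cp : continuous p by move=> x; apply: cvgD; [exact: clq|exact: clr].
have cf : continuous (fun x => dotv (D w t x) (w t x) + dotv (w t x) (D w t x)).
  by move=> x; apply: cvgD; exact: continuous_slice_dotv.
set S := l * slice_dot w w t + slice_dot (D w) (D w) t / l.
have IS : Rintegral mu `[0, T]%classic p = S.
  by rewrite /p IntD // !IntZ // /S (mulrC _ l^-1).
have H y : 0 <= y <= T -> sqnorm (w t th) - S <= sqnorm (w t y).
  move=> yT.
  have := oscillation_le thT yT (fun x => is_derive_dotv_dtha skew t x sw sw) cf cp
     (fun x => young_dotv _ _ l0).
  rewrite IS => h; have := le_trans (ler_norm _) h; rewrite /sqnorm; lra.
have cc : continuous (fun _ : R => sqnorm (w t th) - S) by exact: cst_continuous.
have := Int_le cc cq H; rewrite (Int_cst _ (ltW T0)) subr0 -ler_pdivlMr // => h.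
have -> : (T^-1 + l) * slice_dot w w t + slice_dot (D w) (D w) t / l =
   slice_dot w w t / T + S by rewrite /S; ring.
by rewrite -lerBlDr.
Qed.

Section Poincare.
Hypothesis orth : forall s, (E s)^T *m E s = 1%:M.

(* [x := D u t 0] is recovered from its components along the image and the kernel
   of [h - 1], where [h = E T]: [h x - x] is the increment over a period of the
   untwisted field [E s *m D u t s], and the mean of that field is
   [(h (u t 0) - u t 0) / T]. *)
Lemma twisted_poincare : exists c, 0 <= c /\ forall u t th,
  smooth2 u -> on_cylinder u -> 0 <= th <= T ->
  sqnorm (D u t th) <= c * slice_dot (D (D u)) (D (D u)) t.
Proof.
have [P [Q PQ]] := orth_splitting (orth T).
(* The terms in [P] and [Q] bound [|D u t 0|]; the 1 pays for the oscillation of the untwisted field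
   from 0 to [th]. *)
pose m : R := 1 + K%:R * `|P| + K%:R * `|Q|.
have m0 : 0 <= m by rewrite !addr_ge0 // mulr_ge0.
exists (K%:R * m ^+ 2 * T); split; first by rewrite !mulr_ge0 ?exprn_ge0 ?pi_ge0.
move=> u t th su cu thT.
have sW := smooth2_dtha alpha su; have sDW := smooth2_dtha alpha sW.
have cW := on_cylinder_dtha alpha su cu.
set B := slice_dot _ _ t.
have B0 : 0 <= B by exact: slice_dot_ge0.
pose v s := E s *m u t s; pose w s := E s *m D u t s.
have U0 z (s : R) : smooth2 z ->
    is_derive s 1 (fun s => E s *m z t s) (E s *m D z t s).
  by move=> sz; have := is_derive_untwist alpha t 0 s sz; rewrite addr0;
    under eq_fun do rewrite addr0.
have Dv (s : R) : is_derive s 1 v (w s) by exact: U0.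
have Dw (s : R) : is_derive s 1 w (E s *m D (D u) t s) by exact: U0.
pose sig := Num.sqrt (T * B).
have sig0 : 0 <= sig by exact: sqrtr_ge0.
(* Cauchy-Schwarz on a period: the derivative of the untwisted field has the same norm as [D (D u)],
   as [E x] is orthogonal. *)
have osc s i j : 0 <= s <= T -> `|w s i j - w 0 i j| <= sig.
  move=> sT; pose f x := (E x *m D (D u) t x) i j.
  have Df (x : R) : is_derive x 1 (fun x => w x i j) (f x).
    by have /is_derive_mxP := Dw x; apply.
  have cf : continuous f.
    move=> x; have /is_derive_mxP/(_ i j) := U0 _ x sDW.
    exact: is_derive_continuous.
  have cn : continuous (fun x => `|f x|) by move=> x; apply: cvg_norm; exact: cf.
  have z0 : 0 <= (0 : R) <= T by rewrite lexx ltW.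
  apply: le_trans (oscillation_le sT z0 Df cf cn (fun=> lexx _)) _.
  have I0 : 0 <= Rintegral mu `[0, T]%classic (fun x => `|f x|) by exact: Int_ge0.
  rewrite -(ger0_norm I0) -sqrtr_sqr ler_wsqrtr //.
  apply: le_trans (Int_CauchySchwarz T0 cn) _; rewrite subr0; apply: ler_wpM2l.
    exact: ltW.
  apply: Int_le; [|exact: continuous_slice_dotv|].
    by move=> x; exact: (cvgM (cn x) (cn x)).
  move=> x _; rewrite real_normK ?num_real //; apply: le_trans (sqnorm_coord _ _ _) _.
  by rewrite sqnorm_orth.
have oscn s : 0 <= s <= T -> `|w s - w 0| <= sig.
  by move=> sT; apply: mx_norm_le => // i j; rewrite !mxE; have := osc s i j sT; rewrite !mxE.
have TT : 0 <= T <= T by rewrite lexx ltW.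
have E0 (z : V) : E 0 *m z = z by rewrite expm0 mul1mx.
have wT : E T *m D u t 0 - D u t 0 = w T - w 0.
  by rewrite /w E0; have := cW t 0; rewrite add0r => ->.
have vT : E T *m u t 0 - u t 0 = v T - v 0.
  by rewrite /v E0; have := cu t 0; rewrite add0r => ->.
pose y := T^-1 *: u t 0.
have Hy : `|D u t 0 - (E T *m y - y)| <= sig.
  apply: mx_norm_le => // i j.
  have Dvij (x : R) : is_derive x 1 (fun x => v x i j) (w x i j).
    by have /is_derive_mxP := Dv x; apply.
  (* For each entry the mean of [w] over the period is one of its values, [w c i j], with [c]
     depending on the entry; so the oscillation bound applies to the mean. *)
  have [c cT Ec] := mvt_from0 Dvij (ltW T0).
  have -> : (D u t 0 - (E T *m y - y)) i j = - (w c i j - w 0 i j).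
    rewrite /y -scalemxAr -scalerBr vT.
    have -> : D u t 0 = w 0 by rewrite /w E0.
    rewrite mxE [X in _ + X]mxE [X in - X]mxE [(v T - v 0) i j]mxE [(- v 0) i j]mxE Ec.
    by rewrite [v 0 i j + _]addrC addrK mulrC mulfK ?opprB ?gt_eqF.
  by rewrite normrN; exact: osc.
have Hx : `|D u t 0| <= (K%:R * `|P| + K%:R * `|Q|) * sig.
  rewrite [X in `|X|](PQ (D u t 0) y); apply: le_trans (ler_normD _ _) _.
  rewrite [leRHS]mulrDl -2!(mulrA K%:R); apply: lerD; apply: le_trans (norm_mulmx_le _ _) _.
    by rewrite ler_wpM2l // ler_wpM2l // wT; exact: oscn.
  by rewrite ler_wpM2l // ler_wpM2l.
have Hw : `|w th| <= m * sig.
  have := ler_normD (w th - w 0) (w 0); rewrite subrK.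
  have := oscn th thT; have -> : w 0 = D u t 0 by rewrite /w E0.
  by rewrite /m; lra.
rewrite -(sqnorm_orth _ (orth th)); apply: le_trans (sqnorm_le _) _.
have -> : K%:R * m ^+ 2 * T * B = K%:R * (m * sig) ^+ 2.
  by rewrite exprMn /sig sqr_sqrtr; [ring|rewrite mulr_ge0 // ltW].
by rewrite ler_wpM2l // lerXn2r // nnegrE ?mulr_ge0.
Qed.

End Poincare.
End Slices.

(** * Twisted harmonic maps *)

Lemma tangent_vecS (R : realType) K (S M : set 'cV[R]_K) p v :
  S `<=` M -> tangent_vec S p v -> tangent_vec M p v.
Proof. by move=> SM [g [Sg g0 Dg1 Dg2]]; exists g; split => // s; exact: SM. Qed.

Section TwistedHarmonic.
Variables (R : realType) (K : nat) (alpha : 'M[R]_K) (M : set 'cV[R]_K).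
Notation V := 'cV[R]_K.
Notation D := (dtha alpha).
Notation E s := (expm (s *: alpha)).
Notation mu := (@lebesgue_measure R).
Notation T := (2 * pi : R).

Variable u : R -> R -> V.
Hypothesis hu : twisted_harmonic M alpha u.
Hypothesis orth : forall s, (E s)^T *m E s = 1%:M.
Hypothesis EM : forall s p, M p -> M (E s *m p).

Let T0 : 0 < T. Proof. by rewrite mulr_gt0 // pi_gt0. Qed.
Let skew : alpha^T = - alpha. Proof. exact: orth_expm_skew. Qed.
Let su : smooth2 u. Proof. by case: hu. Qed.
Let cu : on_cylinder u. Proof. by case: hu. Qed.
Let Mu t th : M (u t th). Proof. by case: hu. Qed.
Let st : smooth2 (dt u) := smooth2_dt su.
Let stt : smooth2 (dt (dt u)) := smooth2_dt st.
Let sD : smooth2 (D u) := smooth2_dtha alpha su.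
Let sDD : smooth2 (D (D u)) := smooth2_dtha alpha sD.
Let ct : on_cylinder (dt u) := on_cylinder_dt cu.
Let ctt : on_cylinder (dt (dt u)) := on_cylinder_dt ct.
Let cD : on_cylinder (D u) := on_cylinder_dtha alpha su cu.

Let tension t th := dt (dt u) t th + D (D u) t th.

Let sN : smooth2 tension. Proof. exact: smooth2_add. Qed.

Let ttE : dt (dt u) = (fun t th => tension t th - D (D u) t th).
Proof. by apply/funext => t; apply/funext => th; rewrite /tension addrK. Qed.

Let normalN t th : normal_to M (u t th) (tension t th).
Proof. by case: hu. Qed.

Let dt_normal t th : dotv (dt u t th) (tension t th) = 0.
Proof.
apply: normalN.
have D1 : is_derive (0 : R) 1 (fun s => u (s + t) th) (dt u t th).
  apply: (is_derive_shift1 (f := fun s => u s th)); rewrite add0r.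
  exact: smooth2_derive_t.
have [D2 D3] := D1.
exists (fun s => u (s + t) th); split.
- move=> s; exact: Mu.
- by rewrite add0r.
- exact: D2.
- rewrite derive1E; exact: D3.
Qed.

Section Curvature.
Variable C : R.
Hypothesis C0 : 0 <= C.
Hypothesis HC : forall (g g1 : R -> V) (w n : V),
    (forall s, M (g s)) -> (forall s : R, is_derive s 1 g (g1 s)) ->
    is_derive (0 : R) 1 g1 w -> normal_to M (g 0) n ->
    `|dotv n w| <= C * (`|n| * `|g1 0| ^+ 2).

Let tension_tt t th :
  `|dotv (tension t th) (dt (dt u) t th)| <= C * (`|tension t th| * `|dt u t th| ^+ 2).
Proof.
have := @HC (fun s => u (s + t) th) (fun s => dt u (s + t) th) (dt (dt u) t th)
  (tension t th); rewrite !add0r; apply.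
- by move=> s; exact: Mu.
- move=> s; apply: (is_derive_shift1 (f := fun s => u s th)).
  exact: smooth2_derive_t.
- apply: (is_derive_shift1 (f := fun s => dt u s th)); rewrite add0r.
  exact: smooth2_derive_t.
- exact: normalN.
Qed.

Let tension_DD t th :
  `|dotv (tension t th) (D (D u) t th)| <= C * (`|tension t th| * `|D u t th| ^+ 2).
Proof.
have := @HC (fun s => E s *m u t (s + th)) (fun s => E s *m D u t (s + th))
  (D (D u) t th) (tension t th); rewrite !add0r !expm0 !mul1mx; apply.
- by move=> s; exact: EM.
- by move=> s; exact: is_derive_untwist.
- have := is_derive_untwist alpha t th 0 sD.
  by rewrite add0r expm0 mul1mx.
- exact: normalN.
Qed.

Let density t th := sqnorm (dt u t th) + sqnorm (D u t th).

Let density_ge0 t th : 0 <= density t th.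
Proof. by rewrite addr_ge0 // sqnorm_ge0. Qed.

(** Pair the tension with itself, apply the curvature bound to both of its summands, and divide by
    its norm. *)
Let tension_le t th : `|tension t th| <= C * density t th.
Proof.
have [N0|N0] := eqVneq `|tension t th| 0.
  by rewrite N0 mulr_ge0.
have Np : 0 < `|tension t th| by rewrite lt0r N0 /=.
rewrite -(ler_pM2l Np) -expr2; apply: le_trans (norm_sqr_le_sqnorm _) _.
rewrite {1}/sqnorm {2}/tension dotvDr.
apply: (@le_trans _ _ (C * (`|tension t th| * `|dt u t th| ^+ 2) +
   C * (`|tension t th| * `|D u t th| ^+ 2))).
  by apply: lerD; apply: le_trans (ler_norm _) _.
rewrite -!mulrDr mulrCA; apply: ler_wpM2l => //; apply: ler_wpM2l => //.
by apply: lerD; exact: norm_sqr_le_sqnorm.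
Qed.

(** [C ^+ 2 + 1] instead of [C ^+ 2] keeps the factor positive, as [gap_constant] demands. *)
Let tension_DD_le t th : `|dotv (D (D u) t th) (tension t th)| <=
  (C ^+ 2 + 1) * (density t th * sqnorm (D u t th)).
Proof.
rewrite dotvC; apply: le_trans (tension_DD _ _) _.
apply: (@le_trans _ _ (C * ((C * density t th) * sqnorm (D u t th)))).
  apply: ler_wpM2l => //; apply: ler_pM => //; exact: norm_sqr_le_sqnorm.
rewrite mulrA (mulrA C C) -expr2 -mulrA; apply: ler_wpM2r; last by rewrite lerDl.
by rewrite mulr_ge0 // sqnorm_ge0.
Qed.

Let F := slice_dot (D u) (D u).
Let F1 t := 2 * slice_dot (D u) (dt (D u)) t.
Let F2 t := 2 * (slice_dot (dt (D u)) (dt (D u)) t +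
                 slice_dot (D (D u)) (D (D u)) t - slice_dot (D (D u)) tension t).
Let a t := slice_dot (dt u) (dt u) t + F t.

Let dF (t : R) : is_derive t 1 F (F1 t).
Proof.
apply: (is_derive_eq (is_derive_slice_dot t sD sD)).
by rewrite slice_dotC /F1; ring.
Qed.

(** [W_tt = D u_tt]; one integration by parts moves [D] onto [W], and [u_tt] is then replaced by the
    tension minus [D D u]. *)
Let dF1 (t : R) : is_derive t 1 F1 (F2 t).
Proof.
have sDt : smooth2 (dt (D u)) by exact: smooth2_dt.
have D1 := is_derive_slice_dot t sD sDt.
have D2 : is_derive t 1 F1 _ := is_deriveZ 2 D1.
apply: (is_derive_eq D2); rewrite /GRing.scale /= /F2; congr (2 * _).
rewrite -addrA; congr (_ + _).
rewrite dt_dtha // (dt_dtha alpha st).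
have := slice_dot_parts skew t sD stt cD ctt.
rewrite [in X in X = _ -> _]ttE slice_dotBr // => h.
by rewrite -[LHS]opprK -h opprB.
Qed.

(** The tension is orthogonal to [u_t], so [u_tt] may be replaced by [- D D u] in the derivative,
    and integration by parts cancels the rest. *)
Let hopf_cst t : slice_dot (dt u) (dt u) t - F t = slice_dot (dt u) (dt u) 0 - F 0.
Proof.
pose H s := slice_dot (dt u) (dt u) s - F s.
have dH (s : R) : is_derive s 1 H 0.
  have D1 : is_derive s 1 H _ := is_deriveB (is_derive_slice_dot s st st) (dF s).
  apply: (is_derive_eq D1); rewrite slice_dotC -mulr2n -[_ *+ 2]mulr_natl /F1 -mulrBr.
  have h1 : slice_dot (dt u) (dt (dt u)) s = - slice_dot (dt u) (D (D u)) s.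
    rewrite [in LHS]ttE slice_dotBr // (_ : slice_dot _ tension s = 0) ?sub0r //.
    rewrite /slice_dot (_ : (fun th => _) = (fun=> 0)); last first.
      by apply/funext => th; exact: dt_normal.
    by rewrite Int_cst ?mul0r // ltW.
  rewrite h1 dt_dtha // (slice_dotC _ (D (D u))) (slice_dot_parts skew s sD st cD ct).
  by rewrite opprK subrr mulr0.
have h0 (x : R) : H x = H 0.
  have [c _ E] := @mean_value0 _ (fun y => H y) (fun=> 0) x (fun y _ => dH y).
  by apply/eqP; rewrite -subr_eq0 E mul0r.
exact: h0.
Qed.

Let slice_curvature t S : (forall th, 0 <= th <= T -> sqnorm (D u t th) <= S) ->
  slice_dot (D (D u)) tension t <= (C ^+ 2 + 1) * S * a t.
Proof.
move=> HS.
have cq : continuous (density t).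
  by move=> x; apply: cvgD; exact: continuous_slice_dotv.
have -> : a t = Rintegral mu `[0, T]%classic (density t).
  by rewrite /density IntD //; exact: continuous_slice_dotv.
rewrite -IntZ //; apply: Int_le; first exact: continuous_slice_dotv.
  by move=> x; apply: cvgMl_tmp; exact: cq.
move=> th thT; apply: le_trans (ler_norm _) _; apply: le_trans (tension_DD_le _ _) _.
rewrite -mulrA; apply: ler_wpM2l; first by rewrite addr_ge0 // sqr_ge0.
by rewrite mulrC; apply: ler_wpM2r => //; exact: HS.
Qed.

Let energyE t : energy_sq alpha u t = (Rintegral mu `[t - 1, t + 1]%classic a)%:E.
Proof.
have ca : continuous a.
  move=> x; apply: cvgD; last exact: is_derive_continuous (dF x).
  exact: is_derive_continuous (is_derive_slice_dot x st st).
have cq s : continuous (density s).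
  by move=> x; apply: cvgD; exact: continuous_slice_dotv.
rewrite /energy_sq /Rintegral fineK; last first.
  exact: integrable_fin_num (cont_integrable _ _ ca).
apply: eq_integral => s _.
have -> : a s = Rintegral mu `[0, T]%classic (density s).
  by rewrite /density IntD //; exact: continuous_slice_dotv.
by rewrite /Rintegral fineK //; exact: integrable_fin_num (cont_integrable _ _ (cq s)).
Qed.

(** The gap property is taken as a hypothesis on [eps] because [eps] is fixed before the map. *)
Lemma small_energy_flat (c eps : R) : 0 <= c ->
  (forall t th, 0 <= th <= T ->
     sqnorm (D u t th) <= c * slice_dot (D (D u)) (D (D u)) t) ->
  (forall (F F1 F2 B a : R -> R) (H : R),
   (forall x : R, is_derive x 1 F (F1 x)) -> (forall x : R, is_derive x 1 F1 (F2 x)) ->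
   (forall t, 0 <= F t) -> (forall t, 0 <= B t) ->
   (forall t, a t = H + 2 * F t) -> (forall t, F t <= a t) -> (forall t, `|H| <= a t) ->
   (forall t, Rintegral mu `[t - 1, t + 1]%classic a <= eps ^+ 2) ->
   (forall t, 2 * B t - 2 * (C ^+ 2 + 1) * c * B t * a t <= F2 t) ->
   (forall t l, 0 < l ->
      2 * B t - 2 * (C ^+ 2 + 1) * ((T^-1 + l) * F t + B t / l) * a t <= F2 t) ->
   forall t, B t = 0) ->
  (forall t, (energy_sq alpha u t <= (eps ^+ 2)%:E)%E) ->
  forall t th, D u t th = 0.
Proof.
move=> c0 poincare gap small.
pose B := slice_dot (D (D u)) (D (D u)).
have B0 t : 0 <= B t by exact: slice_dot_ge0.
have F0 t : 0 <= F t by exact: slice_dot_ge0.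
have A0 t : 0 <= slice_dot (dt u) (dt u) t by exact: slice_dot_ge0.
have G0 t : 0 <= slice_dot (dt (D u)) (dt (D u)) t by exact: slice_dot_ge0.
have Bz : forall t, B t = 0.
  apply: (gap F F1 F2 B a (slice_dot (dt u) (dt u) 0 - F 0)) => //.
  - by move=> t; rewrite -(hopf_cst t) /a; ring.
  - by move=> t; rewrite /a lerDr.
  - by move=> t; rewrite -(hopf_cst t) /a ler_norml; have := A0 t; have := F0 t; lra.
  - by move=> t; have := small t; rewrite energyE lee_fin.
  (* The term [|W_t|^2] in [F2] is dropped, here and in the next inequality. *)
  - move=> t; have := slice_curvature (fun th => poincare t th).
    by rewrite /F2 -/B; have := G0 t; lra.
  - move=> t l l0; have := slice_curvature (fun th thT => sup_le_mean skew t sD thT l0).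
    by rewrite /F2 -/B -/F; have := G0 t; lra.
move=> t th; have [th' th'T ->] := periodic_reduce T0 (cD t) th.
by apply: sqnorm_eq0; apply: le_trans (poincare t th' th'T) _; rewrite -/(B t) Bz mulr0.
Qed.

End Curvature.

(** * Maps with vanishing twisted angular derivative *)

(** The untwisted map [exp (s alpha) u t (s + th)] is then constant in [s]; compare its values at 0
    and [2 pi]. *)
Lemma flat_fixed : (forall t th, D u t th = 0) ->
  forall t th, fixset_alpha M alpha (u t th).
Proof.
move=> W0 t th; split; first exact: Mu.
have Dv (s : R) : is_derive s 1 (fun s => E s *m u t (s + th)) 0.
  by have := is_derive_untwist alpha t th s su; rewrite W0 mulmx0.
apply/matrixP => i j.
have Dij (s : R) : is_derive s 1 (fun s => (E s *m u t (s + th)) i j) 0.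
  by have /is_derive_mxP/(_ i j) := Dv s; rewrite mxE.
have [c _] := mvt_from0 (G1 := fun=> 0) Dij (ltW T0).
by rewrite mul0r addr0 add0r expm0 mul1mx addrC cu.
Qed.

Lemma flat_geodesic : (forall t th, D u t th = 0) ->
  forall th, geodesic_in M (fun t => u t th).
Proof.
move=> W0 th; split => [t|t]; first exact: Mu.
have := @normalN t th; rewrite /tension.
have -> : D (D u) t th = 0.
  have W : D u = (fun _ _ : R => 0 : V) by apply/funext => x; apply/funext => y; exact: W0.
  by rewrite W /dtha /dth derive1_cst mulmx0 addr0.
by rewrite addr0.
Qed.

End TwistedHarmonic.

Theorem theorem4p9 (R : realType) (K : nat) (M : set 'cV[R]_K)
  (alpha : 'M[R]_K) :
  submanifold M -> compact M ->
  exists eps : R, 0 < eps /\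
  forall G : set 'M[R]_K,
    orth_group_acting G M -> lie_alg G alpha ->
  forall u : R -> R -> 'cV[R]_K,
    twisted_harmonic M alpha u ->
    (forall t : R, (energy_sq alpha u t <= (eps ^+ 2)%:E)%E) ->
    [/\ (forall t th, dtha alpha u t th = 0),
        (forall th, geodesic_in M (fun t => u t th)),
        (forall t th, fixset_alpha M alpha (u t th))
      & (noncritical G M alpha ->
           (forall t th, fixset0 G M (u t th)) /\
           (forall th, geodesic_in (fixset0 G M) (fun t => u t th)))].
Proof.
move=> SM cM.
(* [eps] is chosen before [G], so orthogonality of the exponentials is decided first, as a property
   of [alpha] alone; if it fails, no [G] is admissible and any [eps] will do. *)
have [orth|north] := pselect
  (forall s, (expm (s *: alpha))^T *m expm (s *: alpha) = 1%:M); last first.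
  exists 1; split => // G [_ GO _ _ _] GA; exfalso; apply: north => s.
  by have [] := GO _ (GA s).
have [C [C0 HC]] := normal_curvature_bound SM cM.
have [c [c0 poincare]] := twisted_poincare orth.
have T0 : 0 < 2 * pi :> R by rewrite mulr_gt0 // pi_gt0.
have D0 : 0 < C ^+ 2 + 1 by rewrite ltr_wpDl // sqr_ge0.
have [eps [eps0 gap]] := gap_constant T0 c0 D0.
exists eps; split => // G [_ _ _ _ GM] GA u hu small.
have EM s p : M p -> M (expm (s *: alpha) *m p) by move=> Mp; exact: GM (GA s) Mp.
have [su cu _ _] := hu.
have W0 := small_energy_flat hu orth EM C0 HC c0
  (fun t th => poincare u t th su cu) gap small.
have geo := flat_geodesic hu W0.
have fixa := flat_fixed hu W0.
split => // nc; have fix0 t th : fixset0 G M (u t th) by rewrite -nc; exact: fixa.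
(* Curves in the fixed set are curves in [M], so a vector normal to [M] is normal to the fixed
   set. *)
split => // th; split => // t v /(@tangent_vecS _ _ _ M) tv.
by have [_] := geo th; apply; apply: tv => p [].
Qed.
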